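(* Let $P$ be a parabolic subgroup of $G$ containing $B$. Identify $H^*(G/P)$ and $H^*(P/B)$ with the subspaces of $H^*(G/B)$ spanned over $\mathbb{C}$ by the Schubert classes indexed by $W^P$ and by $W_P$, respectively. Then the map $p\otimes q\mapsto pq$ (product taken in $H^*(G/B)$) induces a bilinear isomorphism of modules $$H^*(G/P)\otimes H^*(P/B)\;\cong\; H^*(G/B).$$
   Context: $G$ is a complex reductive linear algebraic group, $B$ a fixed Borel subgroup, $T\subseteq B$ the maximal torus, $W$ the Weyl group with simple reflections $s_1,\dots,s_n$ corresponding to the simple roots $\alpha_1,\dots,\alpha_n$, and $\ell$ the length function. For a parabolic subgroup $P\supseteq B$, $W_P\subseteq W$ is the associated subgroup (the Weyl group of $P/B$, generated by the simple reflections it contains), and $W^P$ is the set of minimal-length representatives of the cosets in $W/W_P$. $T$ acts by left multiplication; cohomology has coefficients in $\mathbb{C}$, tensor products of ordinary cohomology are over $\mathbb{C}$, and $\mathbb{C}[\mathfrak{t}^*]=H^*_T(pt)$ is the polynomial ring (symmetric algebra) on $\mathfrak{t}^*$, containing the roots as degree-one elements. The $T$-fixed points of $G/B$ are identified with $W$. Restriction to fixed points is injective, so $H^*_T(G/B)$ is regarded as a $\mathbb{C}[\mathfrak{t}^*]$-subalgebra of the ring of functions $W\to\mathbb{C}[\mathfrak{t}^*]$ with pointwise operations. It is a free $\mathbb{C}[\mathfrak{t}^*]$-module with basis the equivariant Schubert classes $\{\sigma_w : w\in W\}$, given by Billey's formula: for $u\in W$ with any fixed reduced word $u=s_{b_1}\cdots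 s_{b_{\ell(u)}}$, set $\mathbf{r}(\mathbf{i},u)=s_{b_1}\cdots s_{b_{i-1}}(\alpha_{b_i})$; then $$\sigma_v(u)=\sum \prod_{i=1}^{\ell(v)}\mathbf{r}(\mathbf{j_i},u),$$ where the sum is over all $1\le j_1<\dots<j_{\ell(v)}\le \ell(u)$ such that $s_{b_{j_1}}\cdots s_{b_{j_{\ell(v)}}}$ is a reduced word for $v$. $H^*_T(G/P)$ and $H^*_T(P/B)$ are free $\mathbb{C}[\mathfrak{t}^*]$-modules on Schubert classes indexed by $W^P$ and $W_P$, identified with the submodules of $H^*_T(G/B)$ spanned by $\{\sigma_v:v\in W^P\}$ and $\{\sigma_w:w\in W_P\}$. Let $M\subseteq\mathbb{C}[\mathfrak{t}^*]$ be the augmentation ideal (generated by the degree-one elements). For $X=G/B, G/P, P/B$ the ordinary cohomology is $H^*(X)\cong H^*_T(X)/M H^*_T(X)$, and the (ordinary) Schubert classes are the images of the equivariant ones; the identifications of $H^*(G/P)$ and $H^*(P/B)$ inside $H^*(G/B)$ are those induced by the equivariant identifications. *)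

(* Defs.v *)
From HB Require Import structures.
From mathcomp Require Import all_boot all_order all_fingroup all_algebra.
From mathcomp Require Import boolp reals complex freeg mpoly ring.
From mathcomp Require Import generic_quotient ring_quotient.

Set Implicit Arguments.
Unset Strict Implicit.
Unset Printing Implicit Defensive.

Import GRing.Theory.
Local Open Scope ring_scope.
Local Open Scope quotient_scope.

Section Span.
Variables (K : pzRingType) (V : lmodType K).

Definition lspan (X : V -> Prop) : {pred V} := fun v =>
  `[< exists2 s : seq (K * V), (forall y, y \in s -> X y.2)
        & v = \sum_(y <- s) y.1 *: y.2 >].

Lemma lspan_submod (X : V -> Prop) : submod_closed (lspan X).
Proof.
split=> [|a u v /asboolP[s Xs ->] /asboolP[t Xt ->]]; apply/asboolP.
  by exists [::]; rewrite ?big_nil.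
exists ([seq (a * y.1, y.2) | y <- s] ++ t) => [y|].
  by rewrite mem_cat => /orP[/mapP[z /Xs Xz ->]|/Xt].
rewrite big_cat big_map scaler_sumr; congr (_ + _).
by apply: eq_bigr => y _; rewrite scalerA.
Qed.

HB.instance Definition _ (X : V -> Prop) :=
  GRing.isSubmodClosed.Build K V (lspan X) (lspan_submod X).

Lemma mem_lspan (X : V -> Prop) v : X v -> v \in lspan X.
Proof.
move=> Xv; apply/asboolP; exists [:: (1, v)]; last by rewrite big_seq1 scale1r.
by move=> y; rewrite inE => /eqP->.
Qed.

Definition span_type (X : V -> Prop) := {v : V | v \in lspan X}.

HB.instance Definition _ X := [isSub of span_type X for sval].
HB.instance Definition _ X := [Choice of span_type X by <:].
HB.instance Definition _ X :=
  [SubChoice_isSubLmodule of span_type X by <:].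

End Span.

Section LmodQuotient.
Variables (K : pzRingType) (V : lmodType K) (X : V -> Prop).

Definition lquot := Quotient.quot (lspan X).

HB.instance Definition _ := GRing.Zmodule.on lquot.
HB.instance Definition _ := EqQuotient.on lquot.

Definition lclass (v : V) : lquot := \pi v.

Definition lquot_scale (a : K) (x : lquot) : lquot := lclass (a *: repr x).

Lemma lclassD u v : lclass (u + v) = lclass u + lclass v.
Proof. exact: (raddfD (\pi_(Quotient.quot (lspan X)))). Qed.

Lemma lclass_scale a u : lclass (a *: u) = lquot_scale a (lclass u).
Proof.
apply/eqP; rewrite /lquot_scale /lclass /lquot -Quotient.idealrBE -scalerBr.
by rewrite rpredZ // Quotient.idealrBE reprK.
Qed.

Lemma lclass_surj x : exists v, x = lclass v.
Proof. by exists (repr x); rewrite /lclass reprK. Qed.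

Lemma lquot_scaleA a b x :
  lquot_scale a (lquot_scale b x) = lquot_scale (a * b) x.
Proof.
by case: (lclass_surj x) => v ->; rewrite -!lclass_scale scalerA.
Qed.

Lemma lquot_scale1 : left_id 1 lquot_scale.
Proof.
by move=> x; case: (lclass_surj x) => v ->; rewrite -lclass_scale scale1r.
Qed.

Lemma lquot_scaleDr : right_distributive lquot_scale +%R.
Proof.
move=> a x y; case: (lclass_surj x) => u ->; case: (lclass_surj y) => v ->.
by rewrite -lclassD -!lclass_scale -lclassD scalerDr.
Qed.

Lemma lquot_scaleDl x : {morph lquot_scale^~ x : a b / a + b}.
Proof.
move=> a b; case: (lclass_surj x) => u ->.
by rewrite -!lclass_scale -lclassD scalerDl.
Qed.

HB.instance Definition _ := GRing.Zmodule_isLmodule.Build K lquot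
  lquot_scaleA lquot_scale1 lquot_scaleDr lquot_scaleDl.

Lemma lclass_is_linear : linear lclass.
Proof. by move=> a u v; rewrite lclassD lclass_scale. Qed.

HB.instance Definition _ :=
  GRing.isLinear.Build K V lquot *:%R lclass lclass_is_linear.

Lemma lclass_eq0 v : (lclass v == 0) = (v \in lspan X).
Proof. by rewrite -[v in RHS]subr0 Quotient.idealrBE -(raddf0 lclass). Qed.

End LmodQuotient.

Inductive subalg_gen (K : pzRingType) (A : lalgType K) (X : A -> Prop) :
    A -> Prop :=
| Subalg_gen x of X x : subalg_gen X x
| Subalg_one : subalg_gen X 1
| Subalg_lin a x y of subalg_gen X x & subalg_gen X y :
    subalg_gen X (a *: x + y)
| Subalg_mul x y of subalg_gen X x & subalg_gen X y : subalg_gen X (x * y).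

Definition ideal_gen (A : comNzRingType) (X : A -> Prop) : A -> Prop := fun x =>
  exists2 s : seq (A * A), (forall y, y \in s -> X y.2)
    & x = \sum_(y <- s) y.1 * y.2.

Section Tensor.
Variables (K : comNzRingType) (V W : lmodType K).

Let free : lmodType K := {freeg (V * W)%type / K}.
Let gen (v : V) (w : W) : free := << (v, w) >>.

Inductive tensor_rel : free -> Prop :=
| Tensor_addl v v' w : tensor_rel (gen (v + v') w - gen v w - gen v' w)
| Tensor_addr v w w' : tensor_rel (gen v (w + w') - gen v w - gen v w')
| Tensor_scalel a v w : tensor_rel (gen (a *: v) w - a *: gen v w)
| Tensor_scaler a v w : tensor_rel (gen v (a *: w) - a *: gen v w).

Definition tensor := lquot tensor_rel.
HB.instance Definition _ := GRing.Lmodule.on tensor.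

Definition tens (v : V) (w : W) : tensor := lclass tensor_rel (gen v w).

Lemma tensDl v v' w : tens (v + v') w = tens v w + tens v' w.
Proof.
apply/eqP; rewrite -subr_eq0 opprD addrA -!raddfB lclass_eq0.
exact/mem_lspan/Tensor_addl.
Qed.

Lemma tensDr v w w' : tens v (w + w') = tens v w + tens v w'.
Proof.
apply/eqP; rewrite -subr_eq0 opprD addrA -!raddfB lclass_eq0.
exact/mem_lspan/Tensor_addr.
Qed.

Lemma tensZl a v w : tens (a *: v) w = a *: tens v w.
Proof.
apply/eqP; rewrite -subr_eq0 -linearZ -raddfB lclass_eq0.
exact/mem_lspan/Tensor_scalel.
Qed.

Lemma tensZr a v w : tens v (a *: w) = a *: tens v w.
Proof.
apply/eqP; rewrite -subr_eq0 -linearZ -raddfB lclass_eq0.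
exact/mem_lspan/Tensor_scaler.
Qed.

Lemma tens_gen t : exists s : seq (K * (V * W)),
  t = \sum_(y <- s) y.1 *: tens y.2.1 y.2.2.
Proof.
have [x ->] := lclass_surj t.
exists [seq (coeff z x, z) | z <- dom x].
rewrite big_map -[in LHS](freeg_sumE x) raddf_sum; apply: eq_bigr => -[v w] _.
rewrite /tens -linearZ /=; congr lclass; apply/eqP/freeg_eqP => z.
by rewrite coeffZ !coeffU mul1r.
Qed.

Lemma fglift_linear (U : lmodType K) (g : V * W -> U) :
  linear (fglift g : free -> U).
Proof.
have gD : {morph (fglift g : free -> U) : x y / x + y}.
  have gB := @lift_is_additive K (V * W)%type U g.
  have g0 : fglift g (0 : free) = 0 by rewrite -(subrr 0) gB subrr.
  by move=> x y; rewrite -{1}[y]opprK gB -[- y]sub0r gB g0 sub0r opprK.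
have g0 : fglift g (0 : free) = 0.
  by apply: (addrI (fglift g (0 : free))); rewrite -gD !addr0.
have gsum (s : seq (V * W)) (h : V * W -> K) :
    fglift g (\sum_(z <- s) << h z *g z >> : free) = \sum_(z <- s) h z *: g z.
  by elim: s => [|z s IH]; rewrite ?big_nil ?g0 // !big_cons gD IH liftU.
move=> a x y; rewrite gD; congr (_ + _).
rewrite [a *: x]/(fgscale a x) /fgscale gsum -[in RHS](freeg_sumE x) gsum.
by rewrite scaler_sumr; apply: eq_bigr => z _; rewrite scalerA.
Qed.

Lemma tensor_lift (U : lmodType K) (f : V -> W -> U) :
    (forall w, linear (f^~ w)) -> (forall v, linear (f v)) ->
  exists2 phi : {linear tensor -> U}, (forall v w, phi (tens v w) = f v w)
    & forall psi : {linear tensor -> U},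
        (forall v w, psi (tens v w) = f v w) -> psi =1 phi.
Proof.
move=> fl fr; pose F : free -> U := fglift (fun p => f p.1 p.2).
pose Flin := GRing.isLinear.Build K free U *:%R F (fglift_linear _).
pose FL : {linear free -> U} := HB.pack F Flin.
have FLZ a x : FL (a *: x) = a *: FL x by exact: linearZ_LR.
have FLB x y : FL (x - y) = FL x - FL y by exact: raddfB.
have FE v w : FL (gen v w) = f v w by rewrite /= /F liftU scale1r.
have fD w v v' : f (v + v') w = f v w + f v' w.
  by rewrite -[v in LHS]scale1r fl scale1r.
have fD' v w w' : f v (w + w') = f v w + f v w'.
  by rewrite -[w in LHS]scale1r fr scale1r.
have f0 w : f 0 w = 0 by apply: (addrI (f 0 w)); rewrite -fD !addr0.
have f0' v : f v 0 = 0 by apply: (addrI (f v 0)); rewrite -fD' !addr0.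
have fZ a v w : f (a *: v) w = a *: f v w.
  by rewrite -[a *: v]addr0 fl f0 addr0.
have fZ' a v w : f v (a *: w) = a *: f v w.
  by rewrite -[a *: w]addr0 fr f0' addr0.
have Frel x : x \in lspan tensor_rel -> FL x = 0.
  move=> /asboolP[s sP ->]; rewrite raddf_sum big_seq big1 // => y /sP Xy.
  rewrite [LHS]FLZ; case: Xy => [v v' w|v w w'|a v w|a v w].
  - by rewrite !FLB !FE fD addrAC addrK subrr scaler0.
  - by rewrite !FLB !FE fD' addrAC addrK subrr scaler0.
  - by rewrite FLB FLZ !FE fZ subrr scaler0.
  - by rewrite FLB FLZ !FE fZ' subrr scaler0.
have FQ x y : lclass tensor_rel x = lclass tensor_rel y -> FL x = FL y.
  move/eqP; rewrite -subr_eq0 -raddfB lclass_eq0 => /Frel /eqP.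
  by rewrite FLB subr_eq0 => /eqP.
pose G (t : tensor) : U := FL (repr t).
have GE x : G (lclass tensor_rel x) = FL x.
  by apply: FQ; rewrite [LHS]reprK.
have Glin : linear G.
  move=> a t u; have [x ->] := lclass_surj t; have [y ->] := lclass_surj u.
  by rewrite -linearP !GE linearP.
pose GL : {linear tensor -> U} :=
  HB.pack G (GRing.isLinear.Build K tensor U *:%R G Glin).
have GLE v w : GL (tens v w) = f v w by rewrite /= GE FE.
exists GL => // psi psiE t; have [s ->] := tens_gen t.
rewrite !linear_sum; apply: eq_bigr => y _.
by rewrite [LHS](linearZ_LR psi) [RHS](linearZ_LR GL) psiE GLE.
Qed.

End Tensor.

Arguments tens {K V W}.

Definition pairing r (x y : 'rV[int]_r) : int := \sum_(i < r) x 0 i * y 0 i.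

(* A connected complex reductive group G with a Borel subgroup B and a maximal
   torus T in B is encoded by its based root datum.  The character and
   cocharacter lattices of T are both Z^rk, with the standard pairing, so that
   t^* = C^rk. *)
Record based_root_datum := BasedRootDatum {
  rk : nat;
  rootix : finType;
  root : rootix -> 'rV[int]_rk;
  coroot : rootix -> 'rV[int]_rk;
  root_inj : injective root;
  coroot_inj : injective coroot;
  root_corootE : forall a, pairing (root a) (coroot a) = 2;
  refl_root : forall a b, exists c,
    root c = root b - pairing (root b) (coroot a) *: root a;
  refl_coroot : forall a b, exists c,
    coroot c = coroot b - pairing (root a) (coroot b) *: coroot a;
  root_reduced : forall a b, root b <> 2 *: root a;
  nsimple : nat;
  simple : 'I_nsimple -> rootix;
  simple_free : forall c : 'I_nsimple -> int,
    \sum_i c i *: root (simple i) = 0 -> forall i, c i = 0;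
  simple_sign : forall a, exists c : 'I_nsimple -> nat,
    root a = \sum_i root (simple i) *+ c i \/
    root a = - (\sum_i root (simple i) *+ c i)
}.

Section Weyl.
Variable D : based_root_datum.
Implicit Types (a b : rootix D) (J : {set 'I_(nsimple D)}).

Fact reflix_subproof a b : exists c,
  root c == root b - pairing (root b) (coroot a) *: root a.
Proof. by have [c <-] := refl_root a b; exists c. Qed.

Definition reflix a b := xchoose (reflix_subproof a b).

Lemma root_reflix a b :
  root (reflix a b) = root b - pairing (root b) (coroot a) *: root a.
Proof. exact/eqP/(xchooseP (reflix_subproof a b)). Qed.

Lemma pairingB r (x x' y : 'rV[int]_r) :
  pairing (x - x') y = pairing x y - pairing x' y.
Proof.
by rewrite -sumrB; apply: eq_bigr => i _; rewrite !mxE mulrDl mulNr.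
Qed.

Lemma pairingZ r k (x y : 'rV[int]_r) : pairing (k *: x) y = k * pairing x y.
Proof. by rewrite mulr_sumr; apply: eq_bigr => i _; rewrite mxE mulrA. Qed.

Lemma reflixK a : involutive (reflix a).
Proof.
move=> b; apply: root_inj; rewrite !root_reflix pairingB pairingZ.
by rewrite root_corootE; apply/rowP => i; rewrite !mxE; ring.
Qed.

Definition reflection a : {perm rootix D} := perm (inv_inj (@reflixK a)).

Definition weyl_group : {group {perm rootix D}} :=
  <<[set reflection a | a in rootix D]>>%G.

Definition weyl := [subg weyl_group].

Fact reflection_in a : reflection a \in weyl_group.
Proof. by rewrite mem_gen // imset_f. Qed.

Definition srefl (i : 'I_(nsimple D)) : weyl := Subg (reflection_in (simple i)).

(* Permutations multiply from left to right: (u * v) x = v (u x).  The Weyl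
   group acts on t^* from the left, so its product uv is v * u in perm. *)
Definition weyl_mul (u v : weyl) : weyl := (v * u)%g.

Definition wprod (s : seq 'I_(nsimple D)) : weyl :=
  foldr (fun i => weyl_mul (srefl i)) 1%g s.

Definition weyl_root (u : weyl) a : rootix D := sgval u a.

Lemma weyl_root_mul u v a :
  weyl_root (weyl_mul u v) a = weyl_root u (weyl_root v a).
Proof. by rewrite /weyl_root /weyl_mul morphM ?inE // permM. Qed.

Lemma root_srefl i b :
  root (weyl_root (srefl i) b) =
  root b - pairing (root b) (coroot (simple i)) *: root (simple i).
Proof. by rewrite /weyl_root /srefl /= permE root_reflix. Qed.

Definition has_word (u : weyl) : pred nat :=
  [pred k | [exists t : k.-tuple 'I_(nsimple D), wprod t == u]].

Definition wlen (u : weyl) : nat :=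
  if pselect (exists k, has_word u k) is left h then ex_minn h else 0%N.

Definition reduced_word (u : weyl) (s : seq 'I_(nsimple D)) : bool :=
  (wprod s == u) && (size s == wlen u).

(* Parabolic subgroups P containing B correspond to sets J of simple roots: W_ J
   is W_P, and W_min J is W^P. *)
Definition W_ J : {set weyl} := <<[set srefl i | i in J]>>%g.

Definition W_min J : {set weyl} :=
  [set v | [forall w in W_ J, (wlen v <= wlen (weyl_mul v w))%N]].

End Weyl.

Section Cohomology.
Variables (R : realType) (D : based_root_datum).
Variable rw : weyl D -> seq 'I_(nsimple D).

Let S := {mpoly R[i][rk D]}.

Definition root_poly (a : rootix D) : S :=
  \sum_(i < rk D) (root a 0 i)%:~R *: 'X_i.

(* r(i, u) = s_{b_1} ... s_{b_{i-1}} (alpha_{b_i}) where s is a reduced word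
   b_1 ... b_l of u; positions are counted from 0. *)
Definition word_root (s : seq 'I_(nsimple D)) (i : 'I_(size s)) : S :=
  root_poly (weyl_root (wprod (take i s)) (simple (tnth (in_tuple s) i))).

(* sigma_v(u) for a reduced word s of u: A is the set of positions
   j_1 < ... < j_k, which enum lists in increasing order. *)
Definition billey (v : weyl D) (s : seq 'I_(nsimple D)) : S :=
  \sum_(A : {set 'I_(size s)}
         | reduced_word v [seq tnth (in_tuple s) j | j <- enum A])
    \prod_(j in A) word_root j.

Definition wfun := {ffun weyl D -> S^o}.

HB.instance Definition _ := GRing.Lmodule.on wfun.

Definition wfun_mul (f g : wfun) : wfun := [ffun u => (f u : S) * (g u : S)].
Definition wfun_one : wfun := [ffun => 1 : S].

Fact wfun_mulA : associative wfun_mul.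
Proof. by move=> f g h; apply/ffunP=> u; rewrite !ffunE mulrA. Qed.
Fact wfun_mulC : commutative wfun_mul.
Proof. by move=> f g; apply/ffunP=> u; rewrite !ffunE mulrC. Qed.
Fact wfun_mul1 : left_id wfun_one wfun_mul.
Proof. by move=> f; apply/ffunP=> u; rewrite !ffunE mul1r. Qed.
Fact wfun_mulDl : left_distributive wfun_mul +%R.
Proof. by move=> f g h; apply/ffunP=> u; rewrite !ffunE mulrDl. Qed.
Fact wfun_one_neq0 : wfun_one != 0.
Proof. by apply/eqP => /ffunP/(_ 1%g)/eqP; rewrite !ffunE oner_eq0. Qed.

HB.instance Definition _ := GRing.Zmodule_isComNzRing.Build wfun
  wfun_mulA wfun_mulC wfun_mul1 wfun_mulDl wfun_one_neq0.

Fact wfun_scaleAl (a : S) (f g : wfun) : a *: (f * g) = (a *: f) * g.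
Proof. by apply/ffunP=> u; rewrite !ffunE; exact: mulrA. Qed.

HB.instance Definition _ := GRing.Lmodule_isLalgebra.Build S wfun wfun_scaleAl.
HB.instance Definition _ := GRing.Lalgebra_isComAlgebra.Build S wfun.

Definition schubert (v : weyl D) : wfun := [ffun u => billey v (rw u)].

(* H_T^*(G/B) is a C[t^*]-subalgebra of the ring of functions on W (the T-fixed
   points) and has the Schubert classes as a C[t^*]-basis: it is therefore the
   subalgebra generated by them. *)
Definition HT_GB_pred : {pred wfun} := fun f =>
  `[< subalg_gen (fun g => exists v, g = schubert v) f >].

Fact HT_GB_subalg : subalg_closed HT_GB_pred.
Proof.
split=> [|a f g /asboolP Hf /asboolP Hg|f g /asboolP Hf /asboolP Hg].
- by apply/asboolP; exact: Subalg_one.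
- by apply/asboolP; exact: Subalg_lin.
- by apply/asboolP; exact: Subalg_mul.
Qed.

HB.instance Definition _ :=
  GRing.isSubalgClosed.Build S wfun HT_GB_pred HT_GB_subalg.

Definition HT_GB := {f : wfun | f \in HT_GB_pred}.

HB.instance Definition _ := [isSub of HT_GB for sval].
HB.instance Definition _ := [Choice of HT_GB by <:].
HB.instance Definition _ := [SubChoice_isSubComNzRing of HT_GB by <:].
HB.instance Definition _ := [SubZmodule_isSubLmodule of HT_GB by <:].
HB.instance Definition _ :=
  [SubNzRing_SubLmodule_isSubLalgebra of HT_GB by <:].
HB.instance Definition _ := GRing.Lalgebra_isComAlgebra.Build S HT_GB.

Fact schubert_in v : schubert v \in HT_GB_pred.
Proof. by apply/asboolP; apply: Subalg_gen; exists v. Qed.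

Definition HT_schubert (v : weyl D) : HT_GB :=
  exist _ (schubert v) (schubert_in v).

Definition augmentation : S -> Prop := ideal_gen (fun p => p \is 1.-homog).

(* The ideal M H_T^*(G/B), where M is the augmentation ideal of C[t^*]. *)
Definition MHT_GB : {pred HT_GB} := fun h =>
  `[< ideal_gen (fun x => exists2 p, augmentation p & x = p%:A) h >].

Lemma ideal_gen0 (A : comNzRingType) (X : A -> Prop) : ideal_gen X 0.
Proof. by exists [::]; rewrite ?big_nil. Qed.

Lemma ideal_genMD (A : comNzRingType) (X : A -> Prop) a u v :
  ideal_gen X u -> ideal_gen X v -> ideal_gen X (a * u + v).
Proof.
move=> [s Xs ->] [t Xt ->]; exists ([seq (a * y.1, y.2) | y <- s] ++ t) => [y|].
  by rewrite mem_cat => /orP[/mapP[z /Xs Xz ->]|/Xt].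
rewrite big_cat big_map mulr_sumr; congr (_ + _).
by apply: eq_bigr => y _; rewrite mulrA.
Qed.

Lemma augmentation_coeff0 p : augmentation p -> p@_0%MM = 0.
Proof.
move=> [s Xs ->]; rewrite raddf_sum big_seq big1 // => y /Xs Xy.
by rewrite /= rmorphM /= (dhomog_nemf_coeff Xy) ?mulr0 //= mdeg0.
Qed.

Fact MHT_GB_ideal : idealr_closed MHT_GB.
Proof.
split.
- by apply/asboolP; exact: ideal_gen0.
- apply/asboolP => -[s Xs] /(congr1 val); rewrite raddf_sum => /ffunP/(_ 1%g).
  rewrite ffunE sum_ffunE => /(congr1 (mcoeff 0%MM)) /eqP; apply/negP.
  rewrite raddf_sum big_seq big1 => [|y /Xs [p /augmentation_coeff0 p0 ->]].
    by rewrite mcoeff1 eqxx oner_eq0.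
  by rewrite /= !ffunE rmorphM /= [_ *: _]mulr1 p0 mulr0.
- by move=> a u v /asboolP Hu /asboolP Hv; apply/asboolP; exact: ideal_genMD.
Qed.

HB.instance Definition _ := isIdealr.Build HT_GB MHT_GB MHT_GB_ideal.

(* H^*(G/B) = H_T^*(G/B) / M H_T^*(G/B); C acts through C -> C[t^*]. *)
Definition H_GB := Quotient.quot MHT_GB.

HB.instance Definition _ := GRing.ComNzRing.on H_GB.

Definition H_class (h : HT_GB) : H_GB := \pi h.

Definition H_scale (c : R[i]) (x : H_GB) : H_GB := H_class (c%:MP%:A) * x.

Lemma H_class_is_zmod_morphism : zmod_morphism H_class.
Proof. exact: raddfB. Qed.

Lemma H_class_is_monoid_morphism : monoid_morphism H_class.
Proof. by split=> [|x y]; rewrite /H_class !piE. Qed.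

HB.instance Definition _ :=
  GRing.isZmodMorphism.Build HT_GB H_GB H_class H_class_is_zmod_morphism.
HB.instance Definition _ :=
  GRing.isMonoidMorphism.Build HT_GB H_GB H_class H_class_is_monoid_morphism.

Fact H_scaleA a b x : H_scale a (H_scale b x) = H_scale (a * b) x.
Proof.
by rewrite /H_scale mulrA -rmorphM -scalerAl mul1r scalerA mpolyCM.
Qed.

Fact H_scale1 : left_id 1 H_scale.
Proof. by move=> x; rewrite /H_scale mpolyC1 scale1r rmorph1 mul1r. Qed.

Fact H_scaleDr : right_distributive H_scale +%R.
Proof. by move=> a x y; rewrite /H_scale mulrDr. Qed.

Fact H_scaleDl x : {morph H_scale^~ x : a b / a + b}.
Proof.
by move=> a b; rewrite /H_scale mpolyCD scalerDl rmorphD mulrDl.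
Qed.

HB.instance Definition _ := GRing.Zmodule_isLmodule.Build R[i] H_GB
  H_scaleA H_scale1 H_scaleDr H_scaleDl.

Fact H_scaleAl (a : R[i]) (x y : H_GB) : a *: (x * y) = (a *: x) * y.
Proof. exact: mulrA. Qed.

HB.instance Definition _ := GRing.Lmodule_isLalgebra.Build R[i] H_GB H_scaleAl.
HB.instance Definition _ := GRing.Lalgebra_isComAlgebra.Build R[i] H_GB.

Definition H_schubert (v : weyl D) : H_GB := H_class (HT_schubert v).

Variable J : {set 'I_(nsimple D)}.

Definition H_GP :=
  span_type (fun x : H_GB => exists2 v, v \in W_min J & x = H_schubert v).
Definition H_PB :=
  span_type (fun x : H_GB => exists2 w, w \in W_ J & x = H_schubert w).

HB.instance Definition _ := GRing.Lmodule.on H_GP.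
HB.instance Definition _ := GRing.Lmodule.on H_PB.

End Cohomology.

(* Main.v *)
(** Divided differences act on functions from W to the fraction field of C[t^*]
    by (d_i f)(u) = (f(u s_i) - f(u)) / u(alpha_i).  Along a word the product of
    the d_i vanishes if the word is not reduced, and otherwise depends only on
    its value v; call it d_v.  Expanding f(s_{b_1} ... s_{b_l}) letter by letter
    gives f(u) = sum_v sigma_v(u) (d_v f)(1), with Billey's sigma_v, so that the
    functionals f |-> (d_v f)(1) form the dual basis of (sigma_v).  Hence
    d_i sigma_v is sigma_{v s_i} or 0, H_T^*(G/B) is stable under the d_i, and the
    sigma_v form a C[t^*]-basis of it.

    If v, v' are in W^P, w, w' in W_P and l(w) <= l(w'), then d_j sigma_v = 0 for
    s_j in W_P, so d_{v' w'} (sigma_v sigma_w) = d_{v'} (sigma_v d_{w'} sigma_w),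
    whose value at 1 is 1 if (v', w') = (v, w) and 0 otherwise.  The products
    sigma_v sigma_w are thus unitriangular in the Schubert basis. *)

Require Import Defs.
From HB Require Import structures.
From mathcomp Require Import all_boot all_order all_fingroup all_algebra.
From mathcomp Require Import boolp reals complex fraction mpoly ring zify.
From mathcomp Require Import generic_quotient ring_quotient.
Import Defs.

Set Implicit Arguments.
Unset Strict Implicit.
Unset Printing Implicit Defensive.

Import Order.TTheory GRing.Theory Num.Theory.
Local Open Scope ring_scope.

Local Notation "u ** v" := (weyl_mul u v) (at level 40, left associativity).

(** * Roots and reduced words *)

Lemma int_factor2 (k m : int) : k * m = 2 -> 0 <= k -> (k == 1) || (k == 2).
Proof.
move=> e k0; have m1 : 1 <= m by rewrite leNgt; apply/negP => m0; nia.
have k2 : k <= 2 by nia.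
lia.
Qed.

Section Roots.
Variable D : based_root_datum.
Implicit Types (a b c : rootix D) (i j : 'I_(nsimple D)) (u v w : weyl D).
Implicit Types (s t : seq 'I_(nsimple D)).

Definition cartan b a : int := pairing (root b) (coroot a).

Lemma cartan_lin a b c d k :
  root d = root b - k *: root a -> cartan d c = cartan b c - k * cartan a c.
Proof. by move=> dE; rewrite /cartan dE pairingB pairingZ. Qed.

Lemma cartan_diag a : cartan a a = 2.
Proof. exact: root_corootE. Qed.

Lemma root_neq0 a : root a != 0.
Proof.
apply/eqP => a0; have /eqP := cartan_diag a; rewrite /cartan a0.
by rewrite -(scale0r (root a)) pairingZ mul0r eq_sym.
Qed.

Lemma root_reflixE a b : root (reflix a b) = root b - cartan b a *: root a.
Proof. exact: root_reflix. Qed.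

Lemma rootN a : root (reflix a a) = - root a.
Proof. by rewrite root_reflixE cartan_diag; apply/rowP => i; rewrite !mxE; ring. Qed.

(* The two reflections x - <x, g^vee> g and s_a s_b s_a along g = s_a b differ
   by a unipotent permutation of the finite set of roots, so they agree there. *)
Lemma cartan_reflix a b c : cartan (reflix a c) (reflix a b) = cartan c b.
Proof.
set g := reflix a b.
pose k x : int := cartan (reflix a x) b.
have kE x : k x = cartan x b - cartan x a * cartan a b.
  by rewrite /k (cartan_lin (k := cartan x a) b (root_reflixE _ _)).
pose s' := (reflection a * reflection b * reflection a)%g.
pose p := (reflection g * s')%g.
have s'E x : root (s' x) = root x - k x *: root g.
  rewrite /s' !permM !permE !root_reflixE kE.
  have -> : cartan (reflix b (reflix a x)) a =
            - cartan x a - k x * cartan b a.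
    rewrite (cartan_lin (k := k x) a (root_reflixE _ _)).
    rewrite (cartan_lin (k := cartan x a) a (root_reflixE _ _)).
    by rewrite cartan_diag; ring.
  rewrite kE (cartan_lin (k := cartan x a) b (root_reflixE _ _)).
  by apply/rowP => i; rewrite !mxE; ring.
(* [k x] pairs [s_a x] with the coroot of [b], and [k g = 2] because [s_a g = b]. The pairing with
   the coroot of [g] also takes the value 2 at [g], so the difference [h] is constant along [g]. *)
have klin x y m : root y = root x - m *: root g -> k y = k x - m * 2.
  move=> yE; rewrite !kE (cartan_lin b yE) (cartan_lin a yE).
  have := kE g; rewrite {1}/k /g reflixK cartan_diag => ->; ring.
have [h hE] : exists h : rootix D -> int, forall x, h x = cartan x g - k x.
  by eexists.
have pE x : root (p x) = root x + h x *: root g.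
  rewrite /p permM s'E permE (klin _ _ _ (root_reflixE g x)) root_reflixE hE.
  by apply/rowP => i; rewrite !mxE; ring.
have pE' x : root (p x) = root x - (- h x) *: root g by rewrite pE scaleNr opprK.
have hp x : h (p x) = h x.
  by rewrite hE (klin _ _ _ (pE' x)) (cartan_lin g (pE' x)) cartan_diag hE; ring.
have hpn n x : h ((p ^+ n)%g x) = h x.
  elim: n => [|n IH]; first by rewrite expg0 perm1.
  by rewrite expgSr permM hp.
have pnE n x : root ((p ^+ n)%g x) = root x + (h x *+ n) *: root g.
  elim: n => [|n IH]; first by rewrite expg0 perm1 scale0r addr0.
  by rewrite expgSr permM pE IH hpn mulrSr scalerDl addrA.
have h0 x : h x = 0.
  have := pnE #[p]%g x; rewrite expg_order perm1 => /esym/eqP.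
  rewrite -subr_eq0 addrAC subrr add0r => /eqP e.
  have /eqP := congr1 (fun z => pairing z (coroot g)) e.
  rewrite pairingZ root_corootE -(scale0r (root g)) pairingZ mul0r.
  by rewrite mulf_eq0 orbF mulrn_eq0 -leqn0 leqNgt order_gt0 => /eqP.
have := h0 (reflix a c); rewrite hE /k reflixK => /eqP.
by rewrite subr_eq0 => /eqP.
Qed.

Lemma cartan_reflixN a c : cartan (reflix a c) a = - cartan c a.
Proof. by rewrite (cartan_lin a (root_reflixE a c)) cartan_diag; ring. Qed.

Definition pos a := `[< exists c : 'I_(nsimple D) -> nat,
  root a = \sum_i root (simple i) *+ c i >].

Lemma simple_inj (c d : 'I_(nsimple D) -> int) :
  \sum_i c i *: root (simple i) = \sum_i d i *: root (simple i) -> c =1 d.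
Proof.
move=> /eqP; rewrite -subr_eq0 -sumrB => /eqP e i; apply/eqP.
rewrite -subr_eq0; apply/eqP.
apply: (simple_free (c := fun i => c i - d i)).
by rewrite -[RHS]e; apply: eq_bigr => j _; rewrite scalerBl.
Qed.

Lemma simple_coef_nat (c : 'I_(nsimple D) -> nat) :
  \sum_i root (simple i) *+ c i = \sum_i (c i)%:Z *: root (simple i).
Proof. by apply: eq_bigr => i _; rewrite -scaler_nat natz. Qed.

Lemma pos_coef (c : 'I_(nsimple D) -> int) a :
  root a = \sum_i c i *: root (simple i) -> pos a -> forall i, 0 <= c i.
Proof.
move=> e /asboolP[d]; rewrite e simple_coef_nat => /simple_inj cE i.
by rewrite cE.
Qed.

Lemma npos_coef (c : 'I_(nsimple D) -> int) a :
  root a = \sum_i c i *: root (simple i) -> ~~ pos a -> forall i, c i <= 0.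
Proof.
move=> e npa i; have [d [dE|]] := simple_sign a.
  by case/negP: npa; apply/asboolP; exists d.
rewrite e simple_coef_nat -sumrN => dE.
have -> : c i = - (d i)%:Z; last by rewrite oppr_le0.
apply: (simple_inj (d := fun i => - (d i)%:Z)); rewrite dE.
by apply: eq_bigr => j _; rewrite scaleNr.
Qed.

Lemma root_coef a :
  exists c : 'I_(nsimple D) -> int, root a = \sum_i c i *: root (simple i).
Proof.
have [d [] ->] := simple_sign a; rewrite simple_coef_nat; first by eexists.
exists (fun i => - (d i)%:Z); rewrite -sumrN.
by apply: eq_bigr => j _; rewrite scaleNr.
Qed.

(** If a root and its negative had the same sign, all its simple coefficients would be both
    nonnegative and nonpositive, and the root would vanish. *)
Lemma posN a : pos (reflix a a) = ~~ pos a.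
Proof.
have [c cE] := root_coef a.
have cE' : root (reflix a a) = \sum_i (- c i) *: root (simple i).
  by rewrite rootN cE -sumrN; apply: eq_bigr => i _; rewrite scaleNr.
have c0 : (forall i, c i = 0) -> False.
  move=> c0; have /eqP := root_neq0 a; rewrite cE; apply.
  by apply: big1 => i _; rewrite c0 scale0r.
case: (boolP (pos a)) => pa; case: (boolP (pos (reflix a a))) => pna //.
  case: c0 => i; apply/eqP; rewrite eq_le (pos_coef cE pa) andbT.
  by rewrite -oppr_ge0 (pos_coef cE' pna).
case: c0 => i; apply/eqP; rewrite eq_le (npos_coef cE pa) /=.
by rewrite -oppr_le0 (npos_coef cE' pna).
Qed.

Lemma pos_simple i : pos (simple i).
Proof.
apply/asboolP; exists (fun j => (j == i) : nat).
by rewrite (bigD1 i) //= eqxx big1 ?addr0 // => j /negPf ->.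
Qed.

(** The reflection changes only the coefficient of [simple i], so a positive coefficient at another
    simple root survives. One exists: if [b = k alpha_i], pairing with the coroot of [b] leaves
    [k = 1] or [k = 2], and [k = 2] contradicts reducedness of the root system. *)
Lemma pos_reflix_simple i b :
  pos b -> b != simple i -> pos (reflix (simple i) b).
Proof.
move=> pb bi; have [c cE] := root_coef b.
have [j ji cj] : exists2 j, j != i & c j != 0.
  apply/exists_inP; apply: contraNT bi; rewrite negb_exists_in => /forall_inP c0.
  have bE : root b = c i *: root (simple i).
    rewrite cE (bigD1 i) //= big1 ?addr0 // => j /c0; rewrite negbK => /eqP ->.
    by rewrite scale0r.
  have := cartan_diag b; rewrite /cartan [in X in X -> _]bE pairingZ => e2.
  have ci := pos_coef cE pb i.
  have ci2 : (c i == 1) || (c i == 2) by exact: int_factor2 e2 ci.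
  case/orP: ci2 => /eqP ci1; last first.
    by case: (@root_reduced D (simple i) b); rewrite bE ci1.
  by apply/eqP/root_inj; rewrite bE ci1 scale1r.
apply/negP => /negP pnb; pose m := cartan b (simple i).
have cE' : root (reflix (simple i) b) =
    \sum_k (c k - m * (k == i)%:Z) *: root (simple k).
  rewrite root_reflixE -/m {1}cE.
  under [RHS]eq_bigr => k _ do rewrite scalerBl.
  rewrite sumrB; congr (_ - _); rewrite (bigD1 i) //= eqxx mulr1.
  by rewrite big1 ?addr0 // => k /negPf ->; rewrite mulr0 scale0r.
have := npos_coef cE' pnb j; rewrite (negPf ji) mulr0 subr0.
have := pos_coef cE pb j; move: cj; lia.
Qed.

Definition rf a : weyl D := Subg (reflection_in a).

Lemma weyl_mulA u v w : u ** (v ** w) = u ** v ** w.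
Proof. by rewrite /weyl_mul mulgA. Qed.
Lemma weyl_mul1 u : u ** 1%g = u. Proof. by rewrite /weyl_mul mul1g. Qed.
Lemma weyl_1mul u : 1%g ** u = u. Proof. by rewrite /weyl_mul mulg1. Qed.

Lemma weyl_mulI u : injective (weyl_mul u).
Proof. by move=> v w; exact: mulIg. Qed.

Lemma weyl_mulV u : u ** u^-1%g = 1%g. Proof. exact: mulVg. Qed.
Lemma weyl_Vmul u : u^-1%g ** u = 1%g. Proof. exact: mulgV. Qed.

Lemma weyl_root1 a : weyl_root 1%g a = a.
Proof. by rewrite /weyl_root morph1 perm1. Qed.

Lemma weyl_root_inj u : injective (weyl_root u).
Proof. exact: perm_inj. Qed.

Lemma weyl_ext u v : weyl_root u =1 weyl_root v -> u = v.
Proof. by move=> e; apply: val_inj; apply/permP. Qed.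

Lemma weyl_root_rf a b : weyl_root (rf a) b = reflix a b.
Proof. by rewrite /weyl_root /= permE. Qed.

Lemma srefl_rf i : srefl i = rf (simple i). Proof. by []. Qed.

Lemma rfK a : rf a ** rf a = 1%g.
Proof.
by apply: weyl_ext => b; rewrite weyl_root_mul !weyl_root_rf reflixK weyl_root1.
Qed.

Lemma wprod_cat s t : wprod (s ++ t) = wprod s ** wprod t.
Proof. by elim: s => [|i s IH] /=; rewrite ?weyl_1mul // IH weyl_mulA. Qed.

Lemma wprod_rcons s i : wprod (rcons s i) = wprod s ** srefl i.
Proof. by rewrite -cats1 wprod_cat /= weyl_mul1. Qed.

(** [weyl_root] permutes indices of roots only, so linearity of the action is expressed as the
    preservation of relations between three roots. *)
Lemma wprod_lin s a b d k : root d = root b - k *: root a ->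
  root (weyl_root (wprod s) d) =
  root (weyl_root (wprod s) b) - k *: root (weyl_root (wprod s) a).
Proof.
move=> e; elim: s => [|i s IH] /=; first by rewrite !weyl_root1.
rewrite !weyl_root_mul srefl_rf !weyl_root_rf !root_reflixE IH.
rewrite (cartan_lin _ IH); apply/rowP => j; rewrite !mxE; ring.
Qed.

Lemma cartan_wprod s a b :
  cartan (weyl_root (wprod s) b) (weyl_root (wprod s) a) = cartan b a.
Proof.
elim: s => [|i s IH] /=; first by rewrite !weyl_root1.
by rewrite !weyl_root_mul srefl_rf !weyl_root_rf cartan_reflix.
Qed.

Lemma wprod_reflix s a b : weyl_root (wprod s) (reflix a b) =
  reflix (weyl_root (wprod s) a) (weyl_root (wprod s) b).
Proof.
apply: root_inj; rewrite root_reflixE cartan_wprod.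
by rewrite (wprod_lin s (root_reflixE a b)).
Qed.

Lemma wprod_rf s a : wprod s ** rf a = rf (weyl_root (wprod s) a) ** wprod s.
Proof.
apply: weyl_ext => b.
by rewrite !weyl_root_mul !weyl_root_rf wprod_reflix.
Qed.

(* The letter deleted is the one at which the image of [b] turns negative. *)
Lemma exchange s b : pos b -> ~~ pos (weyl_root (wprod s) b) ->
  exists t, [/\ wprod t = wprod s ** rf b, size s = (size t).+1
              & {subset t <= s}].
Proof.
move=> pb; elim: s => [|i s IH] /=; first by rewrite weyl_root1 pb.
rewrite weyl_root_mul srefl_rf weyl_root_rf => npb.
case: (boolP (pos (weyl_root (wprod s) b))) => psb; last first.
  have [t [tE st ts]] := IH psb; exists (i :: t).
  split=> /=; first by rewrite tE weyl_mulA.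
    by rewrite st.
  move=> x; rewrite !inE => /orP[->//|/ts ->]; exact: orbT.
exists s; split=> //; last by move=> x; rewrite inE orbC => ->.
have /eqP bi : weyl_root (wprod s) b == simple i.
  by apply: contraNT npb => bi; apply: pos_reflix_simple.
by rewrite -weyl_mulA wprod_rf bi weyl_mulA rfK weyl_1mul.
Qed.

Variable rw : weyl D -> seq 'I_(nsimple D).
Hypothesis rw_reduced : forall u, reduced_word u (rw u).

Lemma wprod_rw u : wprod (rw u) = u.
Proof. by have /andP[/eqP] := rw_reduced u. Qed.

Lemma size_rw u : size (rw u) = wlen u.
Proof. by have /andP[_ /eqP] := rw_reduced u. Qed.

Lemma wlen_le s : (wlen (wprod s) <= size s)%N.
Proof.
rewrite /wlen; case: pselect => [h|//]; case: ex_minnP => m _; apply.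
by apply/existsP; exists (in_tuple s).
Qed.

Definition reduced s := size s == wlen (wprod s).

Lemma reducedE u s : reduced_word u s = (wprod s == u) && reduced s.
Proof.
by rewrite /reduced_word /reduced; case E: (wprod s == u); rewrite /= ?(eqP E).
Qed.

Lemma reduced_rw u : reduced (rw u).
Proof. by rewrite /reduced wprod_rw size_rw. Qed.

Lemma wlen_mul u v : (wlen (u ** v) <= wlen u + wlen v)%N.
Proof.
by have := wlen_le (rw u ++ rw v); rewrite wprod_cat !wprod_rw size_cat !size_rw.
Qed.

Lemma wlen1 : wlen (1%g : weyl D) = 0%N.
Proof. by apply/eqP; rewrite -leqn0; exact: (wlen_le [::]). Qed.

Lemma wlen_eq0 u : (wlen u == 0%N) = (u == 1%g).
Proof.
apply/eqP/eqP => [|->]; last exact: wlen1.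
by rewrite -size_rw => /size0nil u1; rewrite -(wprod_rw u) u1.
Qed.

Lemma reduced_catr s t : reduced (s ++ t) -> reduced t.
Proof.
rewrite /reduced wprod_cat size_cat => /eqP e.
have := wlen_mul (wprod s) (wprod t); have := wlen_le s; have := wlen_le t.
by rewrite -e; lia.
Qed.

Lemma weyl_root_cartan u a b : cartan (weyl_root u b) (weyl_root u a) = cartan b a.
Proof. by rewrite -(wprod_rw u) cartan_wprod. Qed.

Lemma weyl_root_reflix u a b :
  weyl_root u (reflix a b) = reflix (weyl_root u a) (weyl_root u b).
Proof. by rewrite -(wprod_rw u) wprod_reflix. Qed.

Lemma weyl_rf u a : u ** rf a = rf (weyl_root u a) ** u.
Proof. by rewrite -(wprod_rw u) wprod_rf. Qed.

Lemma posN_root u a : pos (weyl_root u (reflix a a)) = ~~ pos (weyl_root u a).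
Proof. by rewrite weyl_root_reflix posN. Qed.

Lemma wlen_rf_lt u b : pos b -> ~~ pos (weyl_root u b) ->
  (wlen (u ** rf b) < wlen u)%N.
Proof.
move=> pb; rewrite -{1}(wprod_rw u) => /(exchange pb)[t [tE st _]].
by move: tE; rewrite -(size_rw u) st ltnS wprod_rw => <-; exact: wlen_le.
Qed.

(** This is [wlen_rf_lt] for [u s_b], which sends [b] to the negative root [- u b]. *)
Lemma wlen_rf_gt u b : pos b -> pos (weyl_root u b) ->
  (wlen u < wlen (u ** rf b))%N.
Proof.
move=> pb pub; rewrite -{1}(weyl_mul1 u) -(rfK b) weyl_mulA.
by apply: wlen_rf_lt => //; rewrite weyl_root_mul weyl_root_rf posN_root pub.
Qed.

Lemma wlen_srefl_gt u i : pos (weyl_root u (simple i)) ->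
  wlen (u ** srefl i) = (wlen u).+1.
Proof.
move=> pu; have := wlen_rf_gt (pos_simple i) pu; rewrite -srefl_rf.
have := wlen_mul u (srefl i).
have := wlen_le [:: i]; rewrite /= weyl_mul1; lia.
Qed.

(** A positive image raises the length by exactly one. A negative image lowers it, and then the
    longer word cannot be reduced. *)
Lemma reduced_rcons s i :
  reduced (rcons s i) = reduced s && pos (weyl_root (wprod s) (simple i)).
Proof.
rewrite /reduced wprod_rcons size_rcons.
case: (boolP (pos _)) => ps; first by rewrite (wlen_srefl_gt ps) eqSS andbT.
have := wlen_rf_lt (pos_simple i) ps; rewrite -srefl_rf andbF.
by have := wlen_le s; lia.
Qed.

(** The roots [r(i, u)] of Billey's formula, in the order of the letters. For a reduced word they
    form the inversion set of the inverse of its product. *)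
Fixpoint rseq s : seq (rootix D) :=
  if s is i :: s' then simple i :: map (reflix (simple i)) (rseq s') else [::].

Lemma rseq_rcons s i :
  rseq (rcons s i) = rcons (rseq s) (weyl_root (wprod s) (simple i)).
Proof.
elim: s => [|k s IH] /=; first by rewrite weyl_root1.
by rewrite IH map_rcons weyl_root_mul srefl_rf weyl_root_rf.
Qed.

(** Write [b = u c] with [u] the product of the word before its last letter [i]. The reflection
    [s_i] changes the sign of [alpha_i] and [- alpha_i] only, so the inversion set gains exactly
    [u alpha_i]. The description depends on the product alone, not on the word. *)
Lemma mem_rseq s b : reduced s ->
  (b \in rseq s) = pos b && ~~ pos (weyl_root (wprod s)^-1%g b).
Proof.
elim/last_ind: s => [_|s i IH]; first by rewrite invg1 weyl_root1 andbN.
rewrite reduced_rcons => /andP[rs ps].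
rewrite rseq_rcons mem_rcons inE IH // wprod_rcons.
have [c ->] : exists c, b = weyl_root (wprod s) c.
  exists (weyl_root (wprod s)^-1%g b).
  by rewrite -weyl_root_mul weyl_mulV weyl_root1.
rewrite (inj_eq (@weyl_root_inj _)) -!weyl_root_mul.
have -> : weyl_root ((wprod s ** srefl i)^-1%g ** wprod s) c =
          reflix (simple i) c.
  rewrite {1 2}/weyl_mul invMg mulgA mulgV mul1g srefl_rf -weyl_root_rf.
  by congr weyl_root; apply/eqP; rewrite eq_invg_mul; apply/eqP/rfK.
rewrite weyl_Vmul weyl_root1; move: (wprod s) ps {rs IH} => u ps.
have [->|ci] := eqVneq c (simple i); first by rewrite ps posN pos_simple.
case: (boolP (pos (weyl_root _ c))) => //= psc.
have [ci'|ci'] := eqVneq c (reflix (simple i) (simple i)).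
  by rewrite ci' posN_root ps in psc.
congr negb; case: (boolP (pos c)) => pc; first by rewrite pos_reflix_simple.
apply/esym/negP => pic; case/negP: pc.
rewrite -(reflixK (simple i) c); apply: pos_reflix_simple => //.
by apply: contra ci' => /eqP e; rewrite -[X in reflix _ X]e reflixK.
Qed.
End Roots.

(** * Divided differences *)

Section DividedDifferences.
Variables (D : based_root_datum) (rw : weyl D -> seq 'I_(nsimple D)).
Hypothesis rw_reduced : forall u, reduced_word u (rw u).
Variables (F : fieldType) (x : rootix D -> F).
Hypothesis x_reflix : forall a b,
  x (reflix a b) = x b - (cartan b a)%:~R * x a.
Hypothesis x_neq0 : forall a, x a != 0.
Hypothesis x_inj : injective x.
Implicit Types (a b c : rootix D) (i j : 'I_(nsimple D)) (u v w : weyl D).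
Implicit Types (s t : seq 'I_(nsimple D)).

Let fn : lmodType F := {ffun weyl D -> F^o}.
Implicit Types f g : fn.

Lemma xN a : x (reflix a a) = - x a.
Proof. by rewrite x_reflix cartan_diag; ring. Qed.

Definition dd i f : fn :=
  [ffun u => (f (u ** srefl i) - f u) / x (weyl_root u (simple i))].

Lemma dd_is_linear i : linear (dd i).
Proof.
move=> k f g; apply/ffunP => u; rewrite !ffunE.
by rewrite opprD addrACA mulrDl -scalerBr -scalerAl.
Qed.

HB.instance Definition _ i :=
  GRing.isLinear.Build F fn fn *:%R (dd i) (dd_is_linear i).

(** Numerator and denominator of [dd i f] both change sign under [u |-> u s_i], so [dd i f] takes
    equal values at [u] and [u s_i]. *)
Lemma dd_dd i f : dd i (dd i f) = 0.
Proof.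
apply/ffunP => u; rewrite ffunE [dd i f]lock !ffunE -lock !ffunE.
rewrite -weyl_mulA srefl_rf rfK weyl_mul1 weyl_root_mul weyl_root_rf.
rewrite (weyl_root_reflix rw_reduced) xN invrN mulrN -mulNr opprB subrr.
by rewrite mul0r.
Qed.

Definition dds s f : fn := foldr dd f s.

Lemma dds_is_linear s : linear (dds s).
Proof. by elim: s => [|i s IH] k f g //=; rewrite IH linearP. Qed.

HB.instance Definition _ s :=
  GRing.isLinear.Build F fn fn *:%R (dds s) (dds_is_linear s).

Lemma dds_cat s t f : dds (s ++ t) f = dds s (dds t f).
Proof. exact: foldr_cat. Qed.

Lemma dds_rcons s i f : dds (rcons s i) f = dds s (dd i f).
Proof. exact: foldr_rcons. Qed.

(** Multiplication by the function [u |-> u(c)]. Together with the [dd i] these operators satisfy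
    the nil-Hecke relations. *)
Definition hat c f : fn := [ffun u => x (weyl_root u c) * f u].

Lemma dd_hat i c f : dd i (hat c f) =
  hat (reflix (simple i) c) (dd i f) - (cartan c (simple i))%:~R *: f.
Proof.
apply/ffunP => u; rewrite !ffunE weyl_root_mul srefl_rf weyl_root_rf.
rewrite (weyl_root_reflix rw_reduced) x_reflix (weyl_root_cartan rw_reduced).
have e (X Y p q m : F) : X != 0 ->
  ((Y - m * X) * p - Y * q) / X = (Y - m * X) * ((p - q) / X) - m * q.
  by move=> X0; field.
exact: e.
Qed.

(** The words obtained by dropping one letter, each paired with the root of the reflection by which
    its product differs from [wprod s]. They index the correction terms in [dds_hat]. *)
Fixpoint deletions s : seq (rootix D * seq 'I_(nsimple D)) :=
  if s is i :: s' then
    (simple i, s') :: [seq (reflix (simple i) y.1, i :: y.2) | y <- deletions s']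
  else [::].

Lemma deletionsP s y : y \in deletions s ->
  wprod y.2 = rf y.1 ** wprod s /\ size s = (size y.2).+1.
Proof.
elim: s y => [|i s IH] y //=; rewrite inE => /orP[/eqP ->|] /=.
  by rewrite weyl_mulA srefl_rf rfK weyl_1mul.
case/mapP => z /IH[zE sz] ->; split=> /=; last by rewrite sz.
by rewrite zE !weyl_mulA (weyl_rf rw_reduced) srefl_rf weyl_root_rf.
Qed.

Lemma deletions_rseq s : [seq y.1 | y <- deletions s] = rseq s.
Proof.
elim: s => //= i s <-; congr cons; rewrite -!map_comp.
exact: eq_map.
Qed.

(** Move [hat] through the word one letter at a time by [dd_hat]; the correction arising at a letter
    is the word without that letter. *)
Lemma dds_hat s c f : dds s (hat c f) =
  hat (weyl_root (wprod s) c) (dds s f) +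
  \sum_(y <- deletions s)
     (cartan (weyl_root (wprod s) c) y.1)%:~R *: dds y.2 f.
Proof.
elim: s => [|i s IH] /=; first by rewrite weyl_root1 big_nil addr0.
rewrite IH linearD linear_sum /= dd_hat big_cons big_map addrA.
rewrite weyl_root_mul srefl_rf weyl_root_rf; set c' := weyl_root _ c.
congr (_ + _ + _); last first.
  apply: eq_bigr => y _; rewrite linearZ /=.
  by rewrite cartan_reflix.
by rewrite -scaleNr -mulrNz cartan_reflixN.
Qed.

Lemma uniq_rseq s : reduced s -> uniq (rseq s).
Proof.
elim/last_ind: s => [//|s i IH].
rewrite (reduced_rcons rw_reduced) => /andP[rs ps].
rewrite rseq_rcons rcons_uniq IH // andbT (mem_rseq rw_reduced) // ps.
by rewrite -weyl_root_mul weyl_Vmul weyl_root1 pos_simple.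
Qed.

Lemma perm_rseq s t : reduced s -> reduced t -> wprod s = wprod t ->
  perm_eq (rseq s) (rseq t).
Proof.
move=> rs rt st; apply: uniq_perm; rewrite ?uniq_rseq // => b.
by rewrite !(mem_rseq rw_reduced) // st.
Qed.

Definition delta u : fn := [ffun v => (v == u)%:R].

Lemma delta_sum f : f = \sum_u f u *: delta u.
Proof.
apply/ffunP => v; rewrite sum_ffunE (bigD1 v) //= big1 => [|u /negPf uv].
  by rewrite !ffunE eqxx addr0 [_ *: _]mulr1.
by rewrite !ffunE eq_sym uv [_ *: _]mulr0.
Qed.

(** Expanding the differences, [dds s f u] reads [f] only at [u] times products of subwords of
    [s]. *)
Lemma dds_supp s f u :
  (forall t, (size t <= size s)%N -> f (u ** wprod t) = 0) -> dds s f u = 0.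
Proof.
elim: s u => [|i s IH] u f0 /=.
  by have := f0 [::] isT; rewrite weyl_mul1.
rewrite ffunE !IH ?subrr ?mul0r // => t st.
  by rewrite f0 // ltnW.
by rewrite -weyl_mulA (f0 (i :: t)).
Qed.

(** Since [s] is reduced, no shorter word has the same product. Of the expanded differences only the
    term that shifts by every letter survives, and its denominators are the inversions. *)
Lemma dds_delta s u : reduced s ->
  dds s (delta (u ** wprod s)) u = \prod_(b <- rseq s) (x (weyl_root u b))^-1.
Proof.
elim: s u => [|i s IH] u rs /=.
  by rewrite big_nil weyl_mul1 ffunE eqxx.
have rs' : reduced s by apply: (reduced_catr rw_reduced (s := [:: i])).
rewrite ffunE [X in _ - X]dds_supp => [|t st]; last first.
  rewrite ffunE; case: eqP => // /weyl_mulI /(congr1 (@wlen D)) e.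
  move/eqP: rs => /= rs; have := wlen_le t; rewrite e -rs; lia.
rewrite weyl_mulA IH // subr0 mulrC big_cons big_map; congr (_ * _).
by apply: eq_bigr => b _; rewrite weyl_root_mul srefl_rf weyl_root_rf.
Qed.

(* For reduced words s, t of v, the difference dds s - dds t commutes with [hat]
   up to v, because the correction terms depend only on v by induction.  So it
   maps f to a multiple of f(u v), and this multiple is the same for s and t. *)
Lemma dds_wd n :
  (forall s t, size s = n -> reduced s -> reduced t -> wprod s = wprod t ->
     dds s =1 dds t) /\
  (forall s, size s = n -> ~~ reduced s -> dds s =1 (fun => 0)).
Proof.
elim/ltn_ind: n => n IH.
have eqn : forall s t, size s = n -> reduced s -> reduced t ->
    wprod s = wprod t -> dds s =1 dds t.
  move=> s t sn rs rt st f.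
  have tn : size t = n by rewrite -sn (eqP rs) (eqP rt) st.
  pose v := wprod s.
  (* The correction term attached to [b], read off [rf b ** v] alone. If this element is shorter
     than [n.-1], the deleted word is not reduced and contributes 0 by induction. *)
  pose G f b : fn := if wlen (rf b ** v) == n.-1 then dds (rw (rf b ** v)) f else 0.
  have GE g r : size r = n -> wprod r = v ->
      forall y, y \in deletions r -> dds y.2 g = G g y.1.
    move=> rn rv y /deletionsP[yE]; rewrite rn rv in yE * => yn.
    have yn' : size y.2 = n.-1 by rewrite yn.
    have ltn : (n.-1 < n)%N by rewrite yn.
    have [IH1 IH2] := IH _ ltn.
    rewrite /G -yE -{1}yn' eq_sym -[_ == wlen _]/(reduced y.2).
    case: (boolP (reduced y.2)) => ry; last by rewrite IH2.
    by apply: IH1; rewrite ?reduced_rw ?wprod_rw.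
  pose dif g := dds s g - dds t g.
  have difh c g : dif (hat c g) = hat (weyl_root v c) (dif g).
    rewrite /dif !dds_hat -st -/v.
    rewrite (eq_big_seq (fun y => (cartan (weyl_root v c) y.1)%:~R *: G g y.1));
      last by move=> y ys; rewrite (GE g s).
    rewrite [in X in _ - (_ + X)](eq_big_seq
        (fun y => (cartan (weyl_root v c) y.1)%:~R *: G g y.1));
      last by move=> y ys; rewrite (GE g t).
    rewrite -!(big_map (fun y => y.1) xpredT
      (fun b => (cartan (weyl_root v c) b)%:~R *: G g b)) !deletions_rseq.
    rewrite (perm_big _ (perm_rseq rs rt st)) /= opprD addrACA subrr addr0.
    by apply/ffunP => u; rewrite !ffunE mulrBr.
  suff dif0 y : dif (delta y) = 0.
    apply/eqP; rewrite -subr_eq0 (delta_sum f) !linear_sum /= -big_split.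
    rewrite big1 // => y _.
    by rewrite /= !linearZ /= -scalerDr -/(dif _) dif0 scaler0.
  apply/ffunP => u; rewrite [RHS]ffunE; apply/eqP/negPn/negP => nz.
  (* [delta y] is an eigenvector of each [hat c] with eigenvalue [y(c)], whereas after [dif] the
     eigenvalue at [u] is [(u v)(c)]. A nonzero value at [u] makes them equal for all [c]. *)
  have yE : y = u ** v.
    apply: weyl_ext => c; rewrite weyl_root_mul; apply: x_inj.
    have := difh c (delta y).
    have -> : hat c (delta y) = x (weyl_root y c) *: delta y.
      apply/ffunP => z; rewrite !ffunE; case: eqP => [->|_] //.
      by rewrite mulr0 scaler0.
    rewrite /dif !linearZ /= -scalerDr -/(dif _) => /ffunP/(_ u).
    by rewrite [LHS]ffunE [RHS]ffunE; exact: (mulIf nz).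
  case/eqP: nz; rewrite yE /dif [LHS]ffunE [X in _ + X]ffunE.
  rewrite dds_delta // /v st dds_delta //.
  by rewrite (perm_big _ (perm_rseq rs rt st)) subrr.
split=> // s; case/lastP: s => [|s i] sn; first by rewrite /reduced wlen1.
move=> nr f; rewrite dds_rcons.
have ltn : (size s < n)%N by rewrite -sn size_rcons.
case: (boolP (reduced s)) => rs; last by rewrite (proj2 (IH _ ltn)).
move: nr; rewrite (reduced_rcons rw_reduced) rs /= => /[dup] npi.
(* The exchange condition gives a reduced word for [wprod s] ending in [i]. Replacing [s] by it
   produces [dd i] twice in a row, which is zero. *)
case/(exchange (pos_simple i)) => t [tE st ts].
have tiE : wprod (rcons t i) = wprod s.
  by rewrite wprod_rcons tE -weyl_mulA -srefl_rf rfK weyl_mul1.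
have rti : reduced (rcons t i) by rewrite /reduced tiE size_rcons -st.
rewrite (proj1 (IH _ ltn) s (rcons t i)) ?tiE //.
by rewrite dds_rcons dd_dd linear0.
Qed.

Lemma dds_reduced s t : reduced s -> reduced t -> wprod s = wprod t ->
  dds s =1 dds t.
Proof. exact: (proj1 (dds_wd (size s))). Qed.

Lemma dds_nreduced s f : ~~ reduced s -> dds s f = 0.
Proof. by move=> rs; exact: (proj2 (dds_wd (size s))). Qed.

End DividedDifferences.

(** * Parabolic decompositions *)

Section Parabolic.
Variables (D : based_root_datum) (rw : weyl D -> seq 'I_(nsimple D)).
Hypothesis rw_reduced : forall u, reduced_word u (rw u).
Variable J : {set 'I_(nsimple D)}.
Implicit Types (u v w : weyl D) (s t : seq 'I_(nsimple D)).

Lemma srefl_W j : j \in J -> srefl j \in W_ J.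
Proof. by move=> jJ; apply: mem_gen; exact: imset_f. Qed.

Lemma W_mul u v : u \in W_ J -> v \in W_ J -> u ** v \in W_ J.
Proof. by move=> uJ vJ; exact: groupM. Qed.

Lemma wprod_W s : {subset s <= J} -> wprod s \in W_ J.
Proof.
elim: s => [_|i s IH sJ] /=; first exact: group1.
rewrite W_mul ?srefl_W ?sJ ?mem_head // IH // => j js.
by rewrite sJ // inE js orbT.
Qed.

(** Read the letters from the left: a letter that would lower the length is dropped together with an
    earlier one, by exchange. Since no new letters appear, words in [J] stay in [J]. *)
Lemma reduced_subword s :
  exists t, [/\ reduced t, wprod t = wprod s & {subset t <= s}].
Proof.
elim/last_ind: s => [|s i [t [rt tE ts]]].
  by exists [::]; split=> //; rewrite /reduced wlen1.
have sub r : {subset r <= t} -> {subset r <= rcons s i}.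
  by move=> rt' k /rt' /ts ks; rewrite mem_rcons inE ks orbT.
case: (boolP (pos (weyl_root (wprod t) (simple i)))) => pi.
  exists (rcons t i); split; first by rewrite (reduced_rcons rw_reduced) rt pi.
    by rewrite !wprod_rcons tE.
  move=> k; rewrite mem_rcons inE => /orP[/eqP ->|/sub -> //].
  by rewrite mem_rcons mem_head.
have [r [rE sr rt']] := exchange (pos_simple i) pi.
exists r; split; last exact: sub; last by rewrite rE wprod_rcons tE.
have := wlen_rf_lt rw_reduced (pos_simple i) pi; rewrite -rE.
(* The reduced word [t] has one letter more than [r], and its product exceeds that of [r] in length
   by at most one; so [r] is reduced. *)
have := wlen_mul rw_reduced (wprod r) (srefl i).
have -> : wprod r ** srefl i = wprod t.
  by rewrite rE -weyl_mulA srefl_rf rfK weyl_mul1.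
rewrite -(eqP rt) sr.
have := wlen_le [:: i]; rewrite /= weyl_mul1 => l1.
by have := wlen_le r; rewrite /reduced; move: l1; lia.
Qed.

Lemma W_word w : w \in W_ J ->
  exists s, [/\ reduced s, wprod s = w & {subset s <= J}].
Proof.
case/gen_prodgP => n [c cJ ->].
have [s sE sJ] : exists2 s, wprod s = (\prod_(i < n) c i)%g & {subset s <= J}.
  elim: n c cJ => [|n IH] c cJ; first by exists [::]; rewrite ?big_ord0.
  have [s sE sJ] := IH _ (fun i => cJ (widen_ord (leqnSn n) i)).
  have /imsetP[j jJ jE] := cJ ord_max.
  (* [weyl_mul] reverses the product of permutations, so the last factor becomes the first
     letter. *)
  exists (j :: s); first by rewrite /= sE big_ord_recr jE.
  by move=> k; rewrite inE => /orP[/eqP ->|/sJ].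
have [t [rt tE ts]] := reduced_subword s.
by exists t; split=> //; [rewrite tE sE | move=> k /ts /sJ].
Qed.

Lemma W_minP v w : v \in W_min J -> w \in W_ J -> (wlen v <= wlen (v ** w))%N.
Proof. by rewrite inE => /forall_inP; apply. Qed.

Lemma W_min_pos v j : v \in W_min J -> j \in J -> pos (weyl_root v (simple j)).
Proof.
move=> vJ jJ; apply: contraLR (W_minP vJ (srefl_W jJ)) => pv.
by rewrite -ltnNge srefl_rf (wlen_rf_lt rw_reduced) ?pos_simple.
Qed.

(** Let [b] be the image of the next simple root under the part of [s] already read. The reflection
    [s_b] lies in [W_ J], so if [v] made the positive root [b] negative, [v s_b] would be a shorter
    element of the coset of [v]. *)
Lemma reduced_cat v s : v \in W_min J -> reduced s -> {subset s <= J} ->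
  reduced (rw v ++ s).
Proof.
move=> vJ; elim/last_ind: s => [|s j IH]; first by rewrite cats0 reduced_rw.
rewrite -rcons_cat !(reduced_rcons rw_reduced) => /andP[rs pj] sJ.
have jJ : j \in J by rewrite sJ // mem_rcons mem_head.
have sJ' : {subset s <= J}.
  by move=> k ks; rewrite sJ // mem_rcons inE ks orbT.
rewrite IH //= wprod_cat (wprod_rw rw_reduced) weyl_root_mul.
set b := weyl_root (wprod s) _ in pj *.
have bJ : rf b \in W_ J.
  rewrite -(weyl_mul1 (rf b)) -(weyl_mulV (wprod s)) weyl_mulA -wprod_rf.
  by rewrite !W_mul ?srefl_W ?groupV ?wprod_W.
apply: contraLR (W_minP vJ bJ) => pv.
by rewrite -ltnNge (wlen_rf_lt rw_reduced).
Qed.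

(** Take [v = u w] of minimal length in the coset of [u]; the second factor is the inverse of
    [w]. *)
Lemma W_decomp u : exists v w, [/\ v \in W_min J, w \in W_ J & u = v ** w].
Proof.
case: (@arg_minnP _ 1%g (mem (W_ J)) (fun w => wlen (u ** w)) (group1 _)).
move=> w wJ wmin; exists (u ** w), (w^-1)%g; split.
- rewrite inE; apply/forall_inP => z zJ; rewrite -weyl_mulA.
  exact/wmin/W_mul.
- by rewrite groupV.
- by rewrite -weyl_mulA weyl_mulV weyl_mul1.
Qed.

End Parabolic.

(** * Subsets of a nonempty ordinal *)

Lemma enum_filter (T : finType) (A : {pred T}) :
  enum A = [seq k <- enum T | k \in A].
Proof. by rewrite [enum T]enumT. Qed.

Lemma enum_imset_lift n (A : {set 'I_n}) :
  enum (lift ord0 @: A) = map (lift ord0) (enum A).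
Proof.
rewrite enum_filter [in RHS]enum_filter enum_ordSl /= ifN; last first.
  by apply/imsetP => -[k _].
rewrite filter_map; congr map; apply: eq_filter => k /=.
by rewrite (mem_imset _ _ (@lift_inj _ _)).
Qed.

Lemma enum_setU1_lift n (A : {set 'I_n}) :
  enum (ord0 |: lift ord0 @: A) = ord0 :: map (lift ord0) (enum A).
Proof.
rewrite enum_filter [in RHS]enum_filter enum_ordSl /= setU11.
rewrite filter_map; congr (_ :: map _ _); apply: eq_filter => k /=.
by rewrite !inE /= (mem_imset _ _ (@lift_inj _ _)).
Qed.

(** Subsets are separated by whether they contain 0; this drives the induction on the first letter
    in [taylor]. *)
Lemma big_set_ordS (R : Type) (idx : R) (op : Monoid.com_law idx) n
    (G : {set 'I_n.+1} -> R) :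
  \big[op/idx]_(A : {set 'I_n.+1}) G A = \big[op/idx]_(A : {set 'I_n})
    op (G (lift ord0 @: A)) (G (ord0 |: lift ord0 @: A)).
Proof.
have liftK (A : {set 'I_n}) : lift ord0 @^-1: (lift ord0 @: A) = A.
  by apply/setP => k; rewrite inE (mem_imset _ _ (@lift_inj _ _)).
rewrite big_split (bigID (fun A : {set 'I_n.+1} => ord0 \notin A)) /=.
congr (op _ _).
  rewrite (reindex_onto (fun A : {set 'I_n} => lift ord0 @: A)
                        (fun A : {set 'I_n.+1} => lift ord0 @^-1: A)).
    apply: eq_bigl => A; rewrite liftK eqxx andbT.
    by apply/imsetP => -[k _].
  move=> A A0; apply/setP => k; case: (unliftP ord0 k) => [j|] ->.
    by rewrite (mem_imset _ _ (@lift_inj _ _)) inE.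
  by rewrite (negPf A0); apply/imsetP => -[j _].
rewrite (reindex_onto (fun A : {set 'I_n} => ord0 |: lift ord0 @: A)
                      (fun A : {set 'I_n.+1} => lift ord0 @^-1: A)).
  apply: eq_bigl => A; rewrite setU11 /=; apply/eqP/setP => k.
  by rewrite !inE /= (mem_imset _ _ (@lift_inj _ _)).
move=> A; rewrite negbK => A0; apply/setP => k; rewrite !inE.
case: (unliftP ord0 k) => [j|] -> //=.
by rewrite (mem_imset _ _ (@lift_inj _ _)) inE.
Qed.

(** * Billey's formula and duality *)

Section Duality.
Variables (D : based_root_datum) (rw : weyl D -> seq 'I_(nsimple D)).
Hypothesis rw_reduced : forall u, reduced_word u (rw u).
Variables (F : fieldType) (x : rootix D -> F).
Hypothesis x_reflix : forall a b,
  x (reflix a b) = x b - (cartan b a)%:~R * x a.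
Hypothesis x_neq0 : forall a, x a != 0.
Hypothesis x_inj : injective x.
Implicit Types (a b c : rootix D) (i : 'I_(nsimple D)) (u v w : weyl D).
Implicit Types (s t : seq 'I_(nsimple D)).

Let fn : lmodType F := {ffun weyl D -> F^o}.
Implicit Types f g : fn.
Local Notation dx := (dd x).
Local Notation dsx := (dds x).

Definition subword s (A : {set 'I_(size s)}) :=
  [seq tnth (in_tuple s) j | j <- enum A].

(** The root whose polynomial is [word_root], kept as an index so that it can be evaluated through
    any [x]. *)
Definition wroot s (j : 'I_(size s)) : rootix D :=
  weyl_root (wprod (take j s)) (simple (tnth (in_tuple s) j)).

Lemma shift_dd i f u :
  f (u ** srefl i) = f u + x (weyl_root u (simple i)) * dx i f u.
Proof.
have e (X p q : F) : X != 0 -> p = q + X * ((p - q) / X) by move=> X0; field.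
by rewrite ffunE; apply: e.
Qed.

(** Apply the induction hypothesis at [u s_i], then [shift_dd] to each term: the unshifted summand
    belongs to the subset without position 0, the other one to the subset with it. At [u = 1] the
    products are those of Billey's formula. *)
Lemma taylor s f u : f (u ** wprod s) =
  \sum_(A : {set 'I_(size s)})
     (\prod_(j in A) x (weyl_root u (wroot j))) * dsx (subword A) f u.
Proof.
elim: s u => [|i s IH] u /=.
  rewrite weyl_mul1 (bigD1 set0) //= big_set0 mul1r /subword enum_set0.
  by rewrite big1 ?addr0 // => A /set0Pn[[]].
rewrite weyl_mulA IH big_set_ordS /=; apply: eq_bigr => A _.
have tl j : tnth (in_tuple (i :: s)) (lift ord0 j) = tnth (in_tuple s) j.
  by rewrite !(tnth_nth i).
have wl j : @wroot (i :: s) (lift ord0 j) = weyl_root (srefl i) (wroot j).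
  by rewrite /wroot tl -weyl_root_mul.
have w0 : @wroot (i :: s) ord0 = simple i by rewrite /wroot weyl_root1.
have pE : \prod_(j in lift ord0 @: A) x (weyl_root u (@wroot (i :: s) j)) =
    \prod_(j in A) x (weyl_root (u ** srefl i) (wroot j)).
  rewrite big_imset /=; last by move=> k k' _ _; apply: lift_inj.
  by apply: eq_bigr => j _; rewrite wl weyl_root_mul.
have swl : [seq tnth (in_tuple (i :: s)) j | j <- map (lift ord0) (enum A)] =
    subword A.
  by rewrite -map_comp; apply: eq_map => j; rewrite /= tl.
rewrite /subword enum_imset_lift enum_setU1_lift /= swl.
rewrite big_setU1 /=; last by apply/imsetP => -[k _].
rewrite pE w0 (shift_dd i) mulrDr mulrCA mulrA; congr (_ + _ * _).
Qed.

Definition billey_sum v s : F :=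
  \sum_(A : {set 'I_(size s)} | reduced_word v (subword A))
     \prod_(j in A) x (wroot j).

Definition sch v : fn := [ffun u => billey_sum v (rw u)].
Definition coef v f : F := dsx (rw v) f 1%g.

Lemma coef_word s f : reduced s -> dsx s f 1%g = coef (wprod s) f.
Proof.
move=> rs; rewrite /coef.
by rewrite (dds_reduced rw_reduced x_reflix x_neq0 x_inj rs
  (reduced_rw rw_reduced _) (esym (wprod_rw rw_reduced _))).
Qed.

Lemma dds_nil s f : ~~ reduced s -> dsx s f = 0.
Proof. exact: (dds_nreduced rw_reduced x_reflix x_neq0 x_inj). Qed.

Lemma coef_linear v (k : F) f g : coef v (k *: f + g) = k * coef v f + coef v g.
Proof. by rewrite /coef linearP !ffunE. Qed.

HB.instance Definition _ v :=
  GRing.isLinear.Build F fn F^o *:%R (coef v) (coef_linear v).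

Lemma sch_expand f : f = \sum_v coef v f *: sch v.
Proof.
apply/ffunP => u; rewrite sum_ffunE -[in LHS](wprod_rw rw_reduced u).
rewrite -[wprod _]weyl_1mul taylor.
(* Group the subsets by the element that their subword spells; subwords that are not reduced have
   zero divided difference. *)
transitivity (\sum_(A : {set 'I_(size (rw u))})
   \sum_(v | reduced_word v (subword A)) (\prod_(j in A) x (wroot j)) * coef v f).
  apply: eq_bigr => A _.
  under eq_bigr => j _ do rewrite weyl_root1.
  case: (boolP (reduced (subword A))) => rA.
    rewrite (big_pred1 (wprod (subword A))) ?coef_word // => v.
    by rewrite reducedE rA andbT eq_sym.
  rewrite dds_nil // ffunE mulr0 [RHS]big_pred0 // => v.
  by rewrite reducedE (negPf rA) andbF.
rewrite (exchange_big_dep xpredT) //=; apply: eq_bigr => v _.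
by rewrite !ffunE [RHS]mulrC mulr_suml.
Qed.

(* The expansion says that the matrices (sch v u) and (coef v (delta u)) are
   inverse to each other on one side, hence on both. *)
Lemma coef_sch v w : coef v (sch w) = (v == w)%:R.
Proof.
pose B := \matrix_(p < #|weyl D|, q < #|weyl D|) (sch (enum_val q) (enum_val p) : F).
pose C := \matrix_(p < #|weyl D|, q < #|weyl D|)
  coef (enum_val p) (delta F (enum_val q)).
have BC : B *m C = 1%:M.
  apply/matrixP => p q; rewrite !mxE.
  transitivity (delta F (enum_val q) (enum_val p)); last first.
    by rewrite ffunE (inj_eq enum_val_inj).
  rewrite [in RHS](sch_expand (delta F (enum_val q))) sum_ffunE.
  rewrite [RHS](reindex _ (onW_bij _ (@enum_val_bij _))).
  by apply: eq_bigr => k _; rewrite !mxE [in RHS]ffunE mulrC.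
have /matrixP/(_ (enum_rank v) (enum_rank w)) := mulmx1C BC.
rewrite !mxE (inj_eq enum_rank_inj) => <-.
rewrite [in LHS](delta_sum (sch w)) linear_sum.
rewrite [LHS](reindex _ (onW_bij _ (@enum_val_bij _))) /=.
by apply: eq_bigr => k _; rewrite !mxE linearZ !enum_rankK /= [RHS]mulrC.
Qed.

Lemma coef_inj f g : (forall v, coef v f = coef v g) -> f = g.
Proof.
by move=> e; rewrite (sch_expand f) (sch_expand g); apply: eq_bigr => v _; rewrite e.
Qed.

Lemma coef_dd v i f : coef v (dx i f) =
  if pos (weyl_root v (simple i)) then coef (v ** srefl i) f else 0.
Proof.
rewrite /coef -[dsx (rw v) _]dds_rcons.
have := reduced_rcons rw_reduced (rw v) i.
rewrite reduced_rw // (wprod_rw rw_reduced) /=; case: ifP => _ r.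
  by rewrite [LHS]coef_word ?r // wprod_rcons (wprod_rw rw_reduced).
by rewrite [dds _ _ _]dds_nil ?r // ffunE.
Qed.

(** The transpose of [coef_dd] under the duality [coef_sch]: the coefficient at [v] survives only
    when [v s_i = w] is longer than [v]. *)
Lemma dd_sch i w : dx i (sch w) =
  if pos (weyl_root w (simple i)) then 0 else sch (w ** srefl i).
Proof.
apply: coef_inj => v; rewrite coef_dd coef_sch.
have mK u : u ** srefl i ** srefl i = u by rewrite -weyl_mulA srefl_rf rfK weyl_mul1.
have posM u : pos (weyl_root (u ** srefl i) (simple i)) =
    ~~ pos (weyl_root u (simple i)).
  by rewrite weyl_root_mul srefl_rf weyl_root_rf (posN_root rw_reduced).
case: ifP => pv.
  have [<-|vw] := eqVneq; first by rewrite posM pv mK coef_sch eqxx.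
  case: ifP => _; first by rewrite linear0.
  rewrite coef_sch; case: eqP => // ve.
  by rewrite ve mK eqxx in vw.
case: ifP => pw; first by rewrite linear0.
by rewrite coef_sch; case: eqP pv => // ->; rewrite posM pw.
Qed.

Definition one_fn : fn := [ffun => 1].

Lemma dd_const i (k : F) : dx i (k *: one_fn) = 0.
Proof. by apply/ffunP => u; rewrite !ffunE subrr mul0r. Qed.

Lemma sch1 : sch 1%g = one_fn.
Proof.
apply: coef_inj => v; rewrite coef_sch /coef.
case/lastP E: (rw v) => [|s i].
  by rewrite -(wprod_rw rw_reduced v) E eqxx /= ffunE.
rewrite dds_rcons -[one_fn]scale1r [dd _ _ _]dd_const linear0 ffunE.
case: eqP => // v1; have := size_rw rw_reduced v.
by rewrite E size_rcons v1 wlen1.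
Qed.

Definition mulf f g : fn := [ffun u => (f u : F) * (g u : F)].

(** In the twisted Leibniz rule the shifted value [f(u s_i)] is replaced by
    [f(u) + u(alpha_i) (dd i f)(u)]. The right side then needs only products, divided differences
    and the function [u |-> u(alpha_i)], which is what [dd_HT] uses. *)
Lemma dd_mulf i f g : dx i (mulf f g) = mulf (dx i f) g + mulf f (dx i g) +
  mulf (hat x (simple i) one_fn) (mulf (dx i f) (dx i g)).
Proof.
apply/ffunP => u; rewrite !ffunE.
have e (X p q p' q' : F) : X != 0 -> (p * p' - q * q') / X =
   (p - q) / X * q' + q * ((p' - q') / X) + X * 1 * ((p - q) / X * ((p' - q') / X)).
  by move=> X0; field.
exact: e.
Qed.

Lemma dds_mulf s f g : {in s, forall i, dx i f = 0} ->
  dsx s (mulf f g) = mulf f (dsx s g).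
Proof.
elim: s => //= i s IH f0; rewrite /= IH => [|j js]; last first.
  by rewrite f0 // inE js orbT.
rewrite [dd _ _ _]dd_mulf f0 ?mem_head //; apply/ffunP => u.
by rewrite !ffunE mul0r mul0r mulr0 add0r addr0.
Qed.

(** A nonzero coefficient at [v] requires [rw v ++ s] to be a reduced word of [w]; as [s] is already
    at least as long as [w], this forces [v = 1]. *)
Lemma dds_sch s w : reduced s -> (wlen w <= size s)%N ->
  dsx s (sch w) = (wprod s == w)%:R *: one_fn.
Proof.
move=> rs ws; apply: coef_inj => v; rewrite linearZ /= -sch1 coef_sch /coef.
rewrite -[dsx (rw v) _]dds_cat.
case: (boolP (reduced (rw v ++ s))) => rvs; last first.
  rewrite [dds _ _ _]dds_nil // ffunE.
  have [v1|_] := eqVneq v 1%g; last by rewrite [_ *: _]mulr0.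
  move: rvs; have -> : rw v = [::]; last by rewrite /= rs.
  by apply/size0nil; rewrite (size_rw rw_reduced) v1 wlen1.
rewrite [LHS]coef_word // wprod_cat (wprod_rw rw_reduced) coef_sch.
have [->|v1] := eqVneq v 1%g; first by rewrite weyl_1mul [_ *: _]mulr1.
rewrite [_ *: _]mulr0; case: eqP => // vw.
move/eqP: rvs; rewrite size_cat wprod_cat (wprod_rw rw_reduced) vw => e.
move: v1; rewrite -(wlen_eq0 rw_reduced) -(size_rw rw_reduced) => v1.
by move: ws v1; rewrite -e; lia.
Qed.

Variable J : {set 'I_(nsimple D)}.

(* Divided differences along J are linear over the Schubert functions indexed by
   W_min J, and d_v' d_w' = d_(v' w'). *)
Lemma coef_schM v v' w w' : v \in W_min J -> v' \in W_min J ->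
    w' \in W_ J -> (wlen w <= wlen w')%N ->
  coef (v' ** w') (mulf (sch v) (sch w)) = ((v' == v) && (w' == w))%:R.
Proof.
move=> vJ vJ' /(W_word rw_reduced)[s [rs <- sJ]] ww.
have rvs := reduced_cat rw_reduced vJ' rs sJ.
rewrite -{1}(wprod_rw rw_reduced v') -wprod_cat -coef_word //.
rewrite dds_cat dds_mulf => [|j js]; last first.
  by rewrite dd_sch (W_min_pos rw_reduced vJ (sJ _ js)).
rewrite dds_sch ?(eqP rs) //.
have -> k : mulf (sch v) (k *: one_fn) = k *: sch v.
  by apply/ffunP => u; rewrite !ffunE [_ *: 1]mulr1 mulrC.
rewrite linearZ /= ffunE -[X in _ *: X]/(coef v' (sch v)) coef_sch.
by rewrite andbC; case: eqP => _; rewrite ?scale1r ?scale0r.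
Qed.

End Duality.

(** * Equivariant cohomology *)

Section RootPoly.
Variables (R : realType) (D : based_root_datum).
Implicit Types a b : rootix D.

Lemma root_poly_coeff a i : (root_poly R a)@_U_(i) = (root a 0 i)%:~R.
Proof.
rewrite /root_poly raddf_sum (bigD1 i) //= mcoeffZ mcoeffXU eqxx mulr1.
rewrite big1 ?addr0 // => j /negPf ji.
by rewrite mcoeffZ mcoeffXU ji mulr0.
Qed.

Lemma root_poly_inj : injective (@root_poly R D).
Proof.
move=> a b ab; apply: root_inj; apply/rowP => i.
have := congr1 (fun p => p@_U_(i)%MM) ab.
by rewrite /= !root_poly_coeff => /intr_inj.
Qed.

Lemma root_poly_neq0 a : root_poly R a != 0.
Proof.
apply: contra (root_neq0 a) => /eqP a0; apply/eqP/rowP => i; rewrite mxE.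
have := root_poly_coeff a i; rewrite a0 mcoeff0 => /esym/eqP.
by rewrite intr_eq0 => /eqP.
Qed.

Lemma root_poly_reflix a b :
  root_poly R (reflix a b) = root_poly R b - (cartan b a)%:~R * root_poly R a.
Proof.
rewrite mulr_sumr -sumrB; apply: eq_bigr => i _.
rewrite root_reflixE !mxE rmorphB rmorphM /= scalerBl; congr (_ - _).
by rewrite -scalerA scaler_int mulrzl.
Qed.

Definition root_frac a : {fraction {mpoly R[i][rk D]}} := tofrac (root_poly R a).

Lemma root_frac_inj : injective root_frac.
Proof. by move=> a b /eqP; rewrite tofrac_eq => /eqP/root_poly_inj. Qed.

Lemma root_frac_neq0 a : root_frac a != 0.
Proof. by rewrite tofrac_eq0 root_poly_neq0. Qed.

Lemma root_frac_reflix a b :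
  root_frac (reflix a b) = root_frac b - (cartan b a)%:~R * root_frac a.
Proof. by rewrite /root_frac root_poly_reflix tofracB tofracM rmorph_int. Qed.

End RootPoly.

Section Equivariant.
Variables (R : realType) (D : based_root_datum).
Variable rw : weyl D -> seq 'I_(nsimple D).
Hypothesis rw_reduced : forall u, reduced_word u (rw u).
Implicit Types (u v w : weyl D) (s t : seq 'I_(nsimple D)).

Let S := {mpoly R[i][rk D]}.
Let F : fieldType := {fraction S}.
Let x : rootix D -> F := @root_frac R D.
Let fn : lmodType F := {ffun weyl D -> F^o}.
Let x_reflix := @root_frac_reflix R D.
Let x_neq0 := @root_frac_neq0 R D.
Let x_inj := @root_frac_inj R D.
Local Notation coefx := (coef rw x).
Local Notation schx := (sch rw x).

(** Divided differences divide by roots, so classes are moved to functions with values in the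
    fraction field. *)
Definition emb (f : wfun R D) : fn := [ffun u => tofrac (f u : S)].

Lemma emb_inj : injective emb.
Proof.
move=> f g /ffunP fg; apply/ffunP => u; have := fg u; rewrite !ffunE => /eqP.
by rewrite tofrac_eq => /eqP.
Qed.

Lemma embP (a : S) f g : emb (a *: f + g) = tofrac a *: emb f + emb g.
Proof. by apply/ffunP => u; rewrite !ffunE tofracD tofracM. Qed.

Lemma emb0 : emb 0 = 0.
Proof. by apply/ffunP => u; rewrite !ffunE tofrac0. Qed.

Lemma emb1 : emb 1 = one_fn D F.
Proof. by apply/ffunP => u; rewrite !ffunE tofrac1. Qed.

Lemma embD f g : emb (f + g) = emb f + emb g.
Proof. by apply/ffunP => u; rewrite !ffunE tofracD. Qed.

Lemma embZ (a : S) f : emb (a *: f) = tofrac a *: emb f.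
Proof. by apply/ffunP => u; rewrite !ffunE tofracM. Qed.

Lemma embM f g : emb (f * g) = mulf (emb f) (emb g).
Proof. by apply/ffunP => u; rewrite !ffunE tofracM. Qed.

Lemma emb_sum (I : Type) (r : seq I) (P : pred I) (G : I -> wfun R D) :
  emb (\sum_(i <- r | P i) G i) = \sum_(i <- r | P i) emb (G i).
Proof. exact: (big_morph emb embD emb0). Qed.

Lemma emb_schubert v : emb (schubert R rw v) = schx v.
Proof.
apply/ffunP => u; rewrite !ffunE rmorph_sum; apply: eq_bigr => A _.
exact: rmorph_prod.
Qed.

Local Notation HTp := (@HT_GB_pred R D rw).

Lemma dds_const s k : s != [::] -> dds x s (k *: one_fn D F) = 0.
Proof. by case/lastP: s => // s i _; rewrite dds_rcons dd_const linear0. Qed.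

(** The Schubert coefficients of [u |-> u(a)] are polynomials: the root itself in length 0, minus a
    Cartan integer in length 1, and 0 beyond, because divided differences kill constants. *)
Lemma hat_HT a : exists2 h, h \in HTp & emb h = hat x a (one_fn D F).
Proof.
have cP v : exists c : S, tofrac c = coefx v (hat x a (one_fn D F)).
  rewrite /coef; case/lastP: (rw v) => [|s i].
    by exists (root_poly R a); rewrite /= !ffunE mulr1 weyl_root1.
  rewrite dds_rcons (dd_hat rw_reduced x_reflix x_neq0).
  rewrite -[X in hat _ _ (dd _ _ X)]scale1r dd_const.
  have -> : hat x (reflix (simple i) a) 0 = 0.
    by apply/ffunP => u; rewrite !ffunE mulr0.
  rewrite sub0r -scaleNr; have [->|s0] := eqVneq s [::].
    exists (- (cartan a (simple i))%:~R).
    by rewrite /= !ffunE [_ *: _]mulr1 rmorphN rmorph_int.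
  by exists 0; rewrite dds_const // ffunE tofrac0.
have [c cE] := fin_all_exists cP.
exists (\sum_v c v *: schubert R rw v).
  by apply: rpred_sum => v _; rewrite rpredZ ?schubert_in.
rewrite emb_sum [RHS](sch_expand rw_reduced x_reflix x_neq0 x_inj).
by apply: eq_bigr => v _; rewrite embZ emb_schubert cE.
Qed.

(** Induction on the generation of the subalgebra: [dd_sch] handles Schubert classes, and [dd_mulf]
    with [hat_HT] handles products. *)
Lemma dd_HT i f : f \in HTp -> exists2 g, g \in HTp & emb g = dd x i (emb f).
Proof.
move=> /asboolP; elim=> {f} [f [v ->]||a f g _ [f' f'H f'E] _ [g' g'H g'E]|].
- rewrite emb_schubert (dd_sch rw_reduced x_reflix x_neq0 x_inj); case: ifP => _.
    by exists 0; [exact: rpred0 | exact: emb0].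
  by exists (schubert R rw (v ** srefl i)); [exact: schubert_in|exact: emb_schubert].
- exists 0; first exact: rpred0.
  by rewrite emb1 -[one_fn _ _]scale1r dd_const emb0.
- exists (a *: f' + g'); first by rewrite rpredD ?rpredZ.
  by rewrite !embP f'E g'E linearP.
- move=> f g fH [f' f'H f'E] gH [g' g'H g'E].
  have {}fH : f \in HTp by apply/asboolP.
  have {}gH : g \in HTp by apply/asboolP.
  have [h hH hE] := hat_HT (simple i).
  exists (f' * g + f * g' + h * (f' * g')); first by rewrite !rpredD ?rpredM.
  by rewrite (embM f g) (dd_mulf x_neq0) -f'E -g'E -hE -!embM -!embD.
Qed.

(** The iterated divided difference stays in the subalgebra, whose elements have polynomial values,
    in particular at 1. *)
Lemma coef_HT v f : f \in HTp -> exists c : S, tofrac c = coefx v (emb f).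
Proof.
move=> fH; suff [g _ gE] : exists2 g, g \in HTp & emb g = dds x (rw v) (emb f).
  by exists (g 1%g); rewrite /coef -gE ffunE.
elim: (rw v) => [|i s [g gH gE]] /=; first by exists f.
by rewrite -gE; exact: dd_HT.
Qed.

Definition HT_coef v (h : HT_GB R rw) : S := projT1 (cid (coef_HT v (valP h))).

Lemma HT_coefE v h : tofrac (HT_coef v h) = coefx v (emb (val h)).
Proof. by rewrite /HT_coef; case: cid. Qed.

Lemma HT_coefP v (a : S) f g :
  HT_coef v (a *: f + g) = a * HT_coef v f + HT_coef v g.
Proof.
apply/eqP; rewrite -tofrac_eq tofracD tofracM !HT_coefE; apply/eqP.
by rewrite -coef_linear -embP.
Qed.

(** Hence the generated subalgebra is no larger than the span of the Schubert classes. *)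
Lemma HT_expand h : h = \sum_v HT_coef v h *: HT_schubert R rw v.
Proof.
apply/val_inj/emb_inj; rewrite raddf_sum emb_sum.
rewrite [LHS](sch_expand rw_reduced x_reflix x_neq0 x_inj); apply: eq_bigr => v _.
by rewrite /= embZ emb_schubert HT_coefE.
Qed.

Lemma emb_HT_schubertM v w :
  emb (val (HT_schubert R rw v * HT_schubert R rw w)) = mulf (schx v) (schx w).
Proof.
exact: etrans (embM _ _)
  (congr2 (@mulf D F) (emb_schubert v) (emb_schubert w)).
Qed.

Lemma HT_coefM (J : {set 'I_(nsimple D)}) v v' w w' :
    v \in W_min J -> v' \in W_min J -> w' \in W_ J -> (wlen w <= wlen w')%N ->
  HT_coef (v' ** w') (HT_schubert R rw v * HT_schubert R rw w) =
  ((v' == v) && (w' == w))%:R.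
Proof.
move=> vJ vJ' wJ' ww; apply/eqP; rewrite -tofrac_eq HT_coefE emb_HT_schubertM.
by rewrite (coef_schM rw_reduced x_reflix x_neq0 x_inj vJ vJ' wJ' ww) rmorph_nat.
Qed.

End Equivariant.

(** * Ordinary cohomology *)

Lemma lspan_family (K : pzRingType) (V : lmodType K) (I : finType)
    (P : {pred I}) (e : I -> V) (z : V) :
  z \in lspan (fun y => exists2 i, i \in P & y = e i) ->
  exists c : I -> K, z = \sum_(i in P) c i *: e i.
Proof.
case/asboolP => s + ->; elim: s => [|y s IH] sP.
  by exists (fun => 0); rewrite big_nil big1 // => i _; rewrite scale0r.
have [c cE] := IH (fun t ts => sP t (mem_behead (s := y :: s) ts)).
have [i iP yE] := sP y (mem_head _ _).
exists (fun j => (if j == i then y.1 else 0) + c j).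
rewrite big_cons cE yE; under [RHS]eq_bigr => j _ do rewrite scalerDl.
rewrite big_split; congr (_ + _); rewrite (bigD1 i) //= eqxx big1 ?addr0 //.
by move=> j /andP[_ /negPf ->]; rewrite scale0r.
Qed.

Lemma tens_family (K : comNzRingType) (V W : lmodType K) (I : finType)
    (P Q : {pred I}) (e : I -> V) (f : I -> W) :
  (forall p : V, exists a : I -> K, p = \sum_(v in P) a v *: e v) ->
  (forall q : W, exists a : I -> K, q = \sum_(w in Q) a w *: f w) ->
  forall t : tensor V W, exists a : I * I -> K,
  t = \sum_(y in [pred y | (y.1 \in P) && (y.2 \in Q)])
        a y *: tens (e y.1) (f y.2).
Proof.
move=> eP fQ t.
apply: lspan_family; have [s ->] := tens_gen t; apply: rpred_sum => y _.
apply: rpredZ; have [a ->] := eP y.2.1; have [b ->] := fQ y.2.2.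
elim/big_ind: _ => [|p p' Hp Hp'|v vP].
- by rewrite -(scale0r (0 : V)) tensZl scale0r rpred0.
- by rewrite tensDl rpredD.
rewrite tensZl rpredZ //; elim/big_ind: _ => [|q q' Hq Hq'|w wQ].
- by rewrite -(scale0r (0 : W)) tensZr scale0r rpred0.
- by rewrite tensDr rpredD.
rewrite tensZr rpredZ // mem_lspan //; exists (v, w) => //.
by rewrite inE /= vP.
Qed.

(** * Tensor decompositions from unitriangular products *)

Section TriangularTensor.
Variables (K : fieldType) (A : comAlgType K) (I : finType).
Variables (P Q : {pred I}) (e : I -> A) (m : I -> I -> I) (len : I -> nat).
Variable c : I -> A -> K.
Hypothesis cP : forall u (k : K) (x y : A), c u (k *: x + y) = k * c u x + c u y.
Hypothesis c_expand : forall x, x = \sum_u c u x *: e u.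
Hypothesis decomp : forall u, exists v w, [/\ v \in P, w \in Q & u = m v w].
Hypothesis cM : forall v v' w w', v \in P -> v' \in P -> w' \in Q ->
  (len w <= len w')%N ->
  c (m v' w') (e v * e w) = ((v' == v) && (w' == w))%:R.

Variables (V W : lmodType K) (eP : I -> V) (eQ : I -> W).
Hypothesis eP_expand : forall p : V, exists a : I -> K,
  p = \sum_(v in P) a v *: eP v.
Hypothesis eQ_expand : forall q : W, exists a : I -> K,
  q = \sum_(w in Q) a w *: eQ w.
Variable phi : {linear tensor V W -> A}.
Hypothesis phiE : forall v w, v \in P -> w \in Q ->
  phi (tens (eP v) (eQ w)) = e v * e w.

Let c0 u : c u 0 = 0.
Proof.
have := cP u 1 0 0; rewrite scale1r addr0 mul1r => /eqP.
by rewrite -subr_eq0 opprD addrA subrr sub0r oppr_eq0 => /eqP.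
Qed.

Let c_sum u (T : finType) (B : {pred T}) (a : T -> K) (G : T -> A) :
  c u (\sum_(y in B) a y *: G y) = \sum_(y in B) a y * c u (G y).
Proof.
apply: (big_rec2 (fun x y => c u x = y)) => [|y x z _ <-]; first exact: c0.
by rewrite cP.
Qed.

(* A nonzero coefficient of maximal [len] in the second factor is read off by
   the coordinate functional that it determines. *)
Lemma triangular_inj : injective phi.
Proof.
move=> t t' /eqP; rewrite -subr_eq0 -linearB => /eqP.
move=> tt'; apply/eqP; rewrite -subr_eq0; apply/eqP; move: (t - t') tt' => {t'}t.
have [a ->] := tens_family eP_expand eQ_expand t; set B := [pred y | _].
rewrite linear_sum => a0.
have a0' : \sum_(y in B) a y *: (e y.1 * e y.2) = 0.
  rewrite -[RHS]a0; apply: eq_bigr => y /andP[yP yQ].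
  by rewrite linearZ /= phiE.
apply: big1 => y yB; suff -> : a y = 0 by rewrite scale0r.
apply/eqP/negPn/negP => ay.
have y0 : [pred y | (y \in B) && (a y != 0)] y by rewrite /= yB.
case: (arg_maxnP (fun y => len y.2) y0) => z /andP[/= zB az] zmax.
have /andP[zP zQ] := zB.
case/eqP: az; have := c_sum (m z.1 z.2) B a (fun y => e y.1 * e y.2).
rewrite a0' c0 (bigD1 z) //= cM // !eqxx mulr1 big1 ?addr0 // => k /andP[kB kz].
have [->|ak] := eqVneq (a k) 0; first by rewrite mul0r.
have /andP[kP kQ] := kB.
rewrite cM //; last by apply: zmax; rewrite /= kB.
by rewrite -xpair_eqE -!surjective_pairing eq_sym (negPf kz) mulr0.
Qed.

(** By strong induction on [len w], each [e (m v w)] is in the image: by [cM], the product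
    [e v * e w] differs from it by a combination of elements [e (m v' w')] with [len w' < len w]. *)
Lemma triangular_surj x : exists t, phi t = x.
Proof.
have im0 : exists t, phi t = 0 by exists 0; rewrite linear0.
have imP (k : K) y z : (exists t, phi t = y) -> (exists t, phi t = z) ->
    exists t, phi t = k *: y + z.
  by move=> [t <-] [t' <-]; exists (k *: t + t'); rewrite linearP.
have im_sum (B : {pred I}) (a : I -> K) (G : I -> A) :
    (forall u, u \in B -> a u = 0 \/ exists t, phi t = G u) ->
    exists t, phi t = \sum_(u in B) a u *: G u.
  move=> h; elim/big_rec: _ => // u z /h[->|uG] zG; last exact: imP.
  by rewrite scale0r add0r.
have step n : forall v w, v \in P -> w \in Q -> len w = n ->
    exists t, phi t = e (m v w).
  elim/ltn_ind: n => n IH v w vP wQ wn.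
  have := c_expand (e v * e w); rewrite (bigD1 (m v w)) //= cM // !eqxx scale1r.
  move=> /esym/(canRL (addrK _)) ->; rewrite addrC -scaleN1r.
  apply: imP; last by exists (tens (eP v) (eQ w)); rewrite phiE.
  apply: im_sum => u; have [v' [w' [vP' wQ' ->]]] := decomp u => uvw.
  case: (ltnP (len w') n) => [lt|ge]; first by right; apply: IH lt _ _ _ _ _.
  left; rewrite cM ?wn //; case: eqP => //= v'v; case: eqP => // w'w.
  by move: uvw; rewrite v'v w'w unfold_in eqxx.
rewrite (c_expand x); apply: im_sum => u _; right.
by have [v [w [vP wQ ->]]] := decomp u; apply: step vP wQ erefl.
Qed.

Lemma triangular_bij : bijective phi.
Proof.
pose g x := projT1 (cid (triangular_surj x)).
have gK : cancel g phi by move=> x; rewrite /g; case: cid.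
by exists g => // t; apply: triangular_inj; rewrite gK.
Qed.

End TriangularTensor.

(** * Coordinates modulo the augmentation ideal *)

Section Ordinary.
Variables (R : realType) (D : based_root_datum).
Variable rw : weyl D -> seq 'I_(nsimple D).
Hypothesis rw_reduced : forall u, reduced_word u (rw u).
Implicit Types (u v w : weyl D).

Let S := {mpoly R[i][rk D]}.
Local Notation HTc := (HT_coef rw_reduced).

Lemma augmentationP (p : S) : p@_0%MM = 0 -> augmentation p.
Proof.
have aug0 : augmentation (0 : S) by exact: ideal_gen0.
have augMD (a b c : S) :
    augmentation b -> augmentation c -> augmentation (a * b + c).
  exact: ideal_genMD.
move=> p0; rewrite (mpolyE p) big_seq; elim/big_rec: _ => // mm q mp augq.
rewrite -mul_mpolyC; apply: augMD => //.
have /eqP : mm != 0%MM by apply: contraTneq mp => ->; rewrite mcoeff_msupp p0 eqxx.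
(* A nonconstant monomial is divisible by some variable, which is homogeneous of degree one. *)
case: (pickP (fun i => mm i != 0%N)) => [i mi _|m0]; last first.
  by case; apply/mnmP => i; rewrite mnm0E; apply/eqP; rewrite -[_ == _]negbK m0.
rewrite -lep1mP in mi; rewrite -(submK mi) mpolyXD -['X_i]addr0 -[_ * _]addr0.
exists [:: ('X_[mm - U_(i)], 'X_i)] => [y|].
  by rewrite inE => /eqP -> /=; rewrite dhomogX /= mdeg1.
by rewrite big_seq1 !addr0.
Qed.

Lemma H_classM (g h : HT_GB R rw) : H_class (g * h) = H_class g * H_class h.
Proof. by case: (@H_class_is_monoid_morphism R D rw) => _; apply. Qed.

Lemma H_classB (g h : HT_GB R rw) : H_class (g - h) = H_class g - H_class h.
Proof. exact: (@H_class_is_zmod_morphism R D rw). Qed.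

Lemma H_classZ (k : R[i]) (h : HT_GB R rw) :
  H_class (k%:MP *: h) = k *: H_class h.
Proof.
have <- : H_class (k%:MP%:A * h) = k *: H_class h by exact: H_classM.
by rewrite -scalerAl mul1r.
Qed.

(** The polynomial minus its constant term lies in the augmentation ideal and so acts as zero on the
    quotient. *)
Lemma H_class_scale (p : S) (h : HT_GB R rw) :
  H_class (p *: h) = p@_0%MM *: H_class h.
Proof.
rewrite -H_classZ; apply/eqP; rewrite -subr_eq0 -H_classB -scalerBl.
set q := _ - _; have q0 : q@_0%MM = 0.
  by rewrite /q mcoeffB mcoeffC eqxx mulr1 subrr.
apply/eqP; rewrite -(rmorph0 (@H_class R D rw)); apply/eqP.
rewrite -Quotient.idealrBE subr0; apply/asboolP.
exists [:: (h, q%:A)] => [y|]; last by rewrite big_seq1 mulrC -scalerAl mul1r.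
by rewrite inE => /eqP -> /=; exists q => //; exact: augmentationP.
Qed.

(** By linearity over the polynomial ring the coefficients of an element of [MHT_GB] have no
    constant term. This makes [H_coef] independent of the representative. *)
Lemma HT_coef_MHT v (h : HT_GB R rw) : h \in @MHT_GB R D rw -> (HTc v h)@_0%MM = 0.
Proof.
have c0 : HTc v (0 : HT_GB R rw) = 0.
  have := HT_coefP rw_reduced v 1 0 (0 : HT_GB R rw).
  rewrite scale1r addr0 mul1r => /eqP.
  by rewrite -subr_eq0 opprD addrA subrr sub0r oppr_eq0 => /eqP.
case/asboolP => s + ->; elim: s => [|y s IH] sP; first by rewrite big_nil c0 mcoeff0.
have [p /augmentation_coeff0 p0 yE] := sP y (mem_head _ _).
rewrite big_cons yE mulrC -scalerAl mul1r HT_coefP mcoeffD.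
rewrite IH => [|z zs]; last by apply: sP; rewrite inE zs orbT.
by rewrite addr0 rmorphM /= p0 mul0r.
Qed.

Definition H_coef v (x : H_GB R rw) : R[i] := (HTc v (repr x))@_0%MM.

Lemma H_coefE v h : H_coef v (H_class h) = (HTc v h)@_0%MM.
Proof.
have : repr (H_class h) - h \in @MHT_GB R D rw.
  by rewrite Quotient.idealrBE reprK.
move=> /(HT_coef_MHT v); rewrite /H_coef.
rewrite -[_ - _]addrC -scaleN1r HT_coefP mulN1r mcoeffD mcoeffN addrC => /eqP.
by rewrite subr_eq0 => /eqP.
Qed.

Lemma H_coefP v (k : R[i]) (x y : H_GB R rw) :
  H_coef v (k *: x + y) = k * H_coef v x + H_coef v y.
Proof.
have [h ->] : exists h, x = H_class h by exists (repr x); rewrite /H_class reprK.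
have [g ->] : exists g, y = H_class g by exists (repr y); rewrite /H_class reprK.
rewrite -H_classZ -rmorphD !H_coefE HT_coefP mcoeffD rmorphM /=.
by rewrite mcoeffC eqxx mulr1.
Qed.

Lemma H_expand (x : H_GB R rw) : x = \sum_v H_coef v x *: H_schubert R rw v.
Proof.
have [h ->] : exists h, x = H_class h by exists (repr x); rewrite /H_class reprK.
rewrite {1}(HT_expand rw_reduced h) rmorph_sum; apply: eq_bigr => v _.
by rewrite /= H_class_scale H_coefE.
Qed.

Lemma H_coefM (J : {set 'I_(nsimple D)}) v v' w w' :
    v \in W_min J -> v' \in W_min J -> w' \in W_ J -> (wlen w <= wlen w')%N ->
  H_coef (v' ** w') (H_schubert R rw v * H_schubert R rw w) =
  ((v' == v) && (w' == w))%:R.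
Proof.
move=> vJ vJ' wJ' ww; rewrite -H_classM H_coefE.
rewrite (HT_coefM R rw_reduced vJ vJ' wJ' ww).
by case: (_ && _); rewrite ?mcoeff1 ?eqxx ?mcoeff0.
Qed.

End Ordinary.

Lemma span_type_expand (K : pzRingType) (V : lmodType K) (I : finType)
    (P : {pred I}) (e : I -> V) :
  exists2 f : I -> span_type (fun x => exists2 i, i \in P & x = e i),
    forall i, i \in P -> val (f i) = e i
    & forall p, exists a : I -> K, p = \sum_(i in P) a i *: f i.
Proof.
(* Indices outside [P] get the default value 0; the sums range over [P] only. *)
pose f i : span_type (fun x => exists2 i, i \in P & x = e i) := insubd 0 (e i).
have fE i : i \in P -> val (f i) = e i.
  by move=> iP; rewrite val_insubd mem_lspan //; exists i.
exists f => // p; have [a aE] := lspan_family (valP p); exists a; apply: val_inj.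
by rewrite raddf_sum [LHS]aE; apply: eq_bigr => i iP; rewrite -(fE i iP).
Qed.

Theorem corollary3p7 (R : realType) (D : based_root_datum)
    (rw : weyl D -> seq 'I_(nsimple D))
    (rw_reduced : forall u : weyl D, reduced_word u (rw u))
    (J : {set 'I_(nsimple D)}) :
  exists phi : {linear tensor (H_GP R rw J) (H_PB R rw J) -> H_GB R rw},
    (forall (p : H_GP R rw J) (q : H_PB R rw J),
       phi (tens p q) = val p * val q)
    /\ bijective phi.
Proof.
have [||phi phiE _] := @tensor_lift _ (H_GP R rw J) (H_PB R rw J) (H_GB R rw)
  (fun p q => val p * val q).
- by move=> q k p p'; rewrite linearP mulrDl scalerAl.
- by move=> p k q q'; rewrite linearP mulrDr scalerAr.
exists phi; split=> //.
have [eP ePE ePx] := span_type_expand (W_min J) (H_schubert R rw).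
have [eQ eQE eQx] := span_type_expand (W_ J) (H_schubert R rw).
apply: (triangular_bij (H_coefP rw_reduced) (H_expand rw_reduced)
  (W_decomp J) (@H_coefM R D rw rw_reduced J) ePx eQx) => v w vJ wJ.
by rewrite phiE ePE // eQE.
Qed.
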